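(* Let $K$ be a field. As $E$ ranges over all finite directed graphs with exactly two vertices, the lattices (ordered by inclusion) of $\lambda$-reducible ideals of $L_K(E)$ form exactly nine classes up to isomorphism. The classes have the following forms, where $\mathcal{Q}$ denotes the set of monic polynomials in $K[x]$ of degree at least $1$ with nonzero constant term, $p,p',q,q'$ range over $\mathcal{Q}$, a symbol containing $p$ or $q$ stands for a family of distinct elements (one for each polynomial, or pair of polynomials), two members of the same family are ordered by reverse divisibility (e.g. $\langle p\rangle\subseteq\langle p'\rangle$ iff $p'\mid p$, and for pairs reverse divisibility in each coordinate), and a containment written between two families or between an element and a family holds for all members unless restricted: [I] $\langle 0\rangle\subset L$. [II] $\langle 0\rangle\subset\langle p\rangle\subset L$. [III] $\langle 0\rangle\subset\langle v\rangle\subset\langle p\rangle\subset L$. [IV] $\langle 0\rangle\subset\langle p(f)\rangle\subset\langle v\rangle\subset\langle q(e)\rangle\subset L$. [V] $\langle 0\rangle\subset\langle v\rangle\subset L$. [VI] $\langle 0\rangle\subset\langle p\rangle\subset\langle v\rangle\subset L$. [VII] $\langle 0\rangle,\langle u\rangle,\langle v\rangle,L$ with $\langle 0\rangle\subset\langle u\rangle\subset L$, $\langle 0\rangle\subset\langle v\rangle\subset L$, and $\langle u\rangle,\langle v\rangle$ incomparable. [VIII] $\langle 0\rangle,\ \langle p(e)\rangle,\ \langle u\rangle,\ \langle v\rangle,\ \langle p(e),v\rangle,\ L$, with order generated by $\langle 0\rangle\subset\langle p(e)\rangle\subset\langle u\rangle\subset L$, $\langle 0\rangle\subset\langle v\rangle\subset\langle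 p(e),v\rangle\subset L$, the order within families, and $\langle p(e)\rangle\subset\langle p'(e),v\rangle$ whenever $p'\mid p$. [IX] $\langle 0\rangle,\ \langle p(e)\rangle,\ \langle q(f)\rangle,\ \langle p(e),q(f)\rangle,\ \langle u\rangle,\ \langle v\rangle,\ \langle p(e),v\rangle,\ \langle u,q(f)\rangle,\ L$, with order generated by $\langle 0\rangle\subset\langle p(e)\rangle\subset\langle u\rangle\subset\langle u,q(f)\rangle\subset L$, $\langle 0\rangle\subset\langle q(f)\rangle\subset\langle v\rangle\subset\langle p(e),v\rangle\subset L$, the order within families, and, whenever $p'\mid p$ and $q'\mid q$, $\langle p(e)\rangle\subset\langle p'(e),q(f)\rangle$, $\langle q(f)\rangle\subset\langle p(e),q'(f)\rangle$, $\langle p(e),q(f)\rangle\subset\langle p'(e),v\rangle$ and $\langle p(e),q(f)\rangle\subset\langle u,q'(f)\rangle$.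
   Context: A directed graph $E=(E^0,E^1,r,s)$ consists of a set $E^0$ of vertices, a set $E^1$ of edges, and range and source maps $r,s:E^1\to E^0$; it is finite if $E^0,E^1$ are finite; loops and multiple edges are allowed. For each $e\in E^1$ there is a ghost edge $e^*$; let $(E^1)^*=\{e^*: e\in E^1\}$. The Leavitt path algebra $L_K(E)$ is the free (associative) $K$-algebra generated by $E^0\cup E^1\cup (E^1)^*$ subject to: (V) $vw=0$ if $v\ne w$ and $vv=v$, for $v,w\in E^0$; (E1) $e\,r(e)=s(e)\,e=e$ for $e\in E^1$; (E2) $e^*s(e)=r(e)e^*=e^*$ for $e\in E^1$; (CK1) $e^*f=0$ if $e\neq f$ and $e^*e=r(e)$, for $e,f\in E^1$; (CK2) $v=\sum_{e\in E^1,\,s(e)=v}ee^*$ for every $v\in E^0$ with $s^{-1}(v)\ne\varnothing$. Ideals are two-sided. A path is a product $e_1\cdots e_n$ of edges with $r(e_i)=s(e_{i+1})$ (vertices are paths of degree $0$). A closed simple path based at $v$ is a path $e_1\cdots e_n$, $n\ge1$, with $s(e_1)=r(e_n)=v$ and $s(e_i)\ne v$ for $i=2,\dots,n$; it is a cycle if $s(e_i)\neq s(e_j)$ for all $i\ne j$. A vertex $v$ is K1 if there is exactly one closed simple path based at $v$ (it is then a cycle, called a K1 cycle). For a K1 cycle $\lambda$ based at $v$, a $\lambda$-polynomial is an element $p(\lambda)=\sum_{i=0}^d a_i\lambda^i$, $a_i\in K$, with $\lambda^0=v$, at least two nonzero terms, and $a_0\neq 0$. A set $X\subseteq E^0$ is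 hereditary if whenever $v\in X$ and there is a path from $v$ to $w$, then $w\in X$; it is saturated if for each $v$ with $s^{-1}(v)\ne\varnothing$, $\{r(e): s(e)=v\}\subseteq X$ implies $v\in X$. An ideal of $L_K(E)$ is $\lambda$-reducible if it is generated by a set of the form $\{p_a(\lambda_a)\}_{a\in A}\cup\{v_1,\dots,v_n\}$, where $A$ is an arbitrary (possibly empty) index set, each $\lambda_a$ is a K1 cycle (repetition allowed), each $p_a(\lambda_a)$ is a $\lambda_a$-polynomial, and $\{v_1,\dots,v_n\}$ is a hereditary, saturated, possibly empty set of vertices. In the notation of the forms, $L$ is the whole algebra, $\langle 0\rangle$ is the zero ideal, $u,v$ stand for the vertices, and $e$ and $f$ stand for loops at $u$ and $v$ respectively; the symbols serve to name the elements of the nine ordered sets. *)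

(* Defs.v *)
From Stdlib Require Export Relation_Operators.
From HB Require Import structures.
From mathcomp Require Export all_boot all_algebra.
From mathcomp Require Export boolp classical_sets.

Set Implicit Arguments.
Unset Strict Implicit.
Unset Printing Implicit Defensive.

Import GRing.Theory.
Local Open Scope ring_scope.
Local Open Scope quotient_scope.

Record fin_digraph := FinDigraph {
  vertex : finType;
  edge : finType;
  src : edge -> vertex;
  rng : edge -> vertex }.

Section Graph.
Variable E : fin_digraph.

Fixpoint walk (v : vertex E) (p : seq (edge E)) (w : vertex E) : bool :=
  if p is e :: p' then (src e == v) && walk (rng e) p' w else v == w.

Definition closed_simple_path (v : vertex E) (p : seq (edge E)) : bool :=
  [&& p != [::], walk v p v & all (fun e => src e != v) (behead p)].

Definition K1 (v : vertex E) : Prop := exists! p, closed_simple_path v p.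

Definition K1_cycle (v : vertex E) (p : seq (edge E)) : Prop :=
  K1 v /\ closed_simple_path v p.

Definition hereditary (X : {set vertex E}) : Prop :=
  forall v w, v \in X -> (exists p, walk v p w) -> w \in X.

Definition saturated (X : {set vertex E}) : Prop :=
  forall v, (exists e : edge E, src e = v) ->
    (forall e : edge E, src e = v -> rng e \in X) -> v \in X.

End Graph.

(* The Leavitt path algebra is presented literally: formal (not necessarily
   unital) algebra expressions in the generators, modulo the least K-algebra
   congruence containing the defining relations. *)
Section Presentation.
Variables (K : fieldType) (E : fin_digraph).

Inductive lterm : Type :=
  | Tvertex of vertex E
  | Tedge of edge E
  | Tghost of edge E
  | Tzero
  | Topp of lterm
  | Tadd of lterm & lterm
  | Tscale of K & lterm
  | Tmul of lterm & lterm.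

Inductive lcong : lterm -> lterm -> Prop :=
  | lc_refl x : lcong x x
  | lc_sym x y : lcong x y -> lcong y x
  | lc_trans x y z : lcong x y -> lcong y z -> lcong x z
  | lc_opp x x' : lcong x x' -> lcong (Topp x) (Topp x')
  | lc_add x x' y y' :
      lcong x x' -> lcong y y' -> lcong (Tadd x y) (Tadd x' y')
  | lc_scale a x x' : lcong x x' -> lcong (Tscale a x) (Tscale a x')
  | lc_mul x x' y y' :
      lcong x x' -> lcong y y' -> lcong (Tmul x y) (Tmul x' y')
  | lc_addA x y z : lcong (Tadd x (Tadd y z)) (Tadd (Tadd x y) z)
  | lc_addC x y : lcong (Tadd x y) (Tadd y x)
  | lc_add0 x : lcong (Tadd Tzero x) x
  | lc_addN x : lcong (Tadd (Topp x) x) Tzero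
  | lc_scaleA a b x : lcong (Tscale a (Tscale b x)) (Tscale (a * b) x)
  | lc_scale1 x : lcong (Tscale 1 x) x
  | lc_scaleDr a x y :
      lcong (Tscale a (Tadd x y)) (Tadd (Tscale a x) (Tscale a y))
  | lc_scaleDl a b x :
      lcong (Tscale (a + b) x) (Tadd (Tscale a x) (Tscale b x))
  | lc_mulA x y z : lcong (Tmul x (Tmul y z)) (Tmul (Tmul x y) z)
  | lc_mulDl x y z : lcong (Tmul (Tadd x y) z) (Tadd (Tmul x z) (Tmul y z))
  | lc_mulDr x y z : lcong (Tmul x (Tadd y z)) (Tadd (Tmul x y) (Tmul x z))
  | lc_scaleAl a x y : lcong (Tscale a (Tmul x y)) (Tmul (Tscale a x) y)
  | lc_scaleAr a x y : lcong (Tscale a (Tmul x y)) (Tmul x (Tscale a y))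
  | lc_Vneq v w : v != w -> lcong (Tmul (Tvertex v) (Tvertex w)) Tzero
  | lc_Vid v : lcong (Tmul (Tvertex v) (Tvertex v)) (Tvertex v)
  | lc_E1r e : lcong (Tmul (Tedge e) (Tvertex (rng e))) (Tedge e)
  | lc_E1s e : lcong (Tmul (Tvertex (src e)) (Tedge e)) (Tedge e)
  | lc_E2s e : lcong (Tmul (Tghost e) (Tvertex (src e))) (Tghost e)
  | lc_E2r e : lcong (Tmul (Tvertex (rng e)) (Tghost e)) (Tghost e)
  | lc_CK1neq e f : e != f -> lcong (Tmul (Tghost e) (Tedge f)) Tzero
  | lc_CK1eq e : lcong (Tmul (Tghost e) (Tedge e)) (Tvertex (rng e))
  | lc_CK2 v : (exists e : edge E, src e = v) ->
      lcong (Tvertex v)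
        (\big[Tadd/Tzero]_(e : edge E | src e == v) Tmul (Tedge e) (Tghost e)).

HB.instance Definition _ := gen_eqMixin lterm.
HB.instance Definition _ := gen_choiceMixin lterm.

Definition lcongb (x y : lterm) : bool := `[< lcong x y >].

Lemma lcongb_equiv : equiv_class_of lcongb.
Proof.
split.
- by move=> x; apply/asboolP; exact: lc_refl.
- by move=> x y; apply/asboolP/asboolP; exact: lc_sym.
- move=> y x z /asboolP xy /asboolP yz; apply/asboolP; exact: lc_trans xy yz.
Qed.

Canonical lcong_equiv := EquivRelPack lcongb_equiv.

Definition leavitt := {eq_quot lcong_equiv}.
HB.instance Definition _ := Choice.on leavitt.
HB.instance Definition _ := Quotient.on leavitt.

Definition lpi (x : lterm) : leavitt := \pi_leavitt x.

Lemma lpiP x y : lpi x = lpi y <-> lcong x y.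
Proof.
split=> [/eqmodP /asboolP //|xy]; by apply/eqmodP/asboolP.
Qed.

Lemma lreprK (x : leavitt) : lpi (repr x) = x.
Proof. exact: reprK. Qed.

Lemma lrepr_pi x : lcong (repr (lpi x)) x.
Proof. by apply/lpiP; rewrite lreprK. Qed.

Definition ladd (x y : leavitt) := lpi (Tadd (repr x) (repr y)).
Definition lopp (x : leavitt) := lpi (Topp (repr x)).
Definition lscale (a : K) (x : leavitt) := lpi (Tscale a (repr x)).
Definition lmul (x y : leavitt) := lpi (Tmul (repr x) (repr y)).

Lemma lpi_add x y : lpi (Tadd x y) = ladd (lpi x) (lpi y).
Proof. by apply/lpiP/lc_sym/lc_add; apply: lrepr_pi. Qed.
Lemma lpi_opp x : lpi (Topp x) = lopp (lpi x).
Proof. by apply/lpiP/lc_sym/lc_opp; apply: lrepr_pi. Qed.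
Lemma lpi_scale a x : lpi (Tscale a x) = lscale a (lpi x).
Proof. by apply/lpiP/lc_sym/lc_scale; apply: lrepr_pi. Qed.
Lemma lpi_mul x y : lpi (Tmul x y) = lmul (lpi x) (lpi y).
Proof. by apply/lpiP/lc_sym/lc_mul; apply: lrepr_pi. Qed.

Definition lpiE := (lpi_add, lpi_opp, lpi_scale, lpi_mul).

Lemma laddA : associative ladd.
Proof.
move=> x y z; rewrite -(lreprK x) -(lreprK y) -(lreprK z) -!lpiE.
by apply/lpiP; constructor.
Qed.
Lemma laddC : commutative ladd.
Proof.
move=> x y; rewrite -(lreprK x) -(lreprK y) -!lpiE.
by apply/lpiP; constructor.
Qed.
Lemma ladd0 : left_id (lpi Tzero) ladd.
Proof. by move=> x; rewrite -(lreprK x) -!lpiE; apply/lpiP; constructor. Qed.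
Lemma laddN : left_inverse (lpi Tzero) lopp ladd.
Proof. by move=> x; rewrite -(lreprK x) -!lpiE; apply/lpiP; constructor. Qed.

HB.instance Definition _ := GRing.isZmodule.Build leavitt laddA laddC ladd0 laddN.

Lemma lscaleA a b x : lscale a (lscale b x) = lscale (a * b) x.
Proof. by rewrite -(lreprK x) -!lpiE; apply/lpiP; constructor. Qed.
Lemma lscale1 : left_id 1 lscale.
Proof. by move=> x; rewrite -(lreprK x) -!lpiE; apply/lpiP; constructor. Qed.
Lemma lscaleDr : right_distributive lscale +%R.
Proof.
move=> a x y; rewrite -(lreprK x) -(lreprK y) /GRing.add /= -!lpiE.
by apply/lpiP; constructor.
Qed.
Lemma lscaleDl x : {morph lscale^~ x : a b / a + b}.
Proof.
move=> a b; rewrite -(lreprK x) [RHS]/GRing.add /= -!lpiE.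
by apply/lpiP; constructor.
Qed.

HB.instance Definition _ :=
  GRing.Zmodule_isLmodule.Build K leavitt lscaleA lscale1 lscaleDr lscaleDl.

Lemma lmulA : associative lmul.
Proof.
move=> x y z; rewrite -(lreprK x) -(lreprK y) -(lreprK z) -!lpiE.
by apply/lpiP; constructor.
Qed.
Lemma lmulDl : left_distributive lmul +%R.
Proof.
move=> x y z; rewrite -(lreprK x) -(lreprK y) -(lreprK z) /GRing.add /= -!lpiE.
by apply/lpiP; constructor.
Qed.
Lemma lmulDr : right_distributive lmul +%R.
Proof.
move=> x y z; rewrite -(lreprK x) -(lreprK y) -(lreprK z) /GRing.add /= -!lpiE.
by apply/lpiP; constructor.
Qed.

Lemma lscale_mull a (x y : leavitt) : a *: lmul x y = lmul (a *: x) y.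
Proof.
rewrite -(lreprK x) -(lreprK y) /GRing.scale /= -!lpiE.
by apply/lpiP; constructor.
Qed.
Lemma lscale_mulr a (x y : leavitt) : a *: lmul x y = lmul x (a *: y).
Proof.
rewrite -(lreprK x) -(lreprK y) /GRing.scale /= -!lpiE.
by apply/lpiP; constructor.
Qed.

Definition lvertex (v : vertex E) : leavitt := lpi (Tvertex v).
Definition ledge (e : edge E) : leavitt := lpi (Tedge e).
Definition lghost (e : edge E) : leavitt := lpi (Tghost e).

(* No unit is adjoined: since E is finite, the sum of the vertices is a
   two-sided identity by (V), (E1) and (E2). *)
Definition lone : leavitt := \sum_(v : vertex E) lvertex v.

Lemma lmul0l (x : leavitt) : lmul 0 x = 0.
Proof. by apply: (@addrI _ (lmul 0 x)); rewrite -lmulDl !addr0. Qed.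
Lemma lmul0r (x : leavitt) : lmul x 0 = 0.
Proof. by apply: (@addrI _ (lmul x 0)); rewrite -lmulDr !addr0. Qed.

Lemma lmul_suml (I : finType) (F : I -> leavitt) y :
  lmul (\sum_i F i) y = \sum_i lmul (F i) y.
Proof.
by apply: (big_morph (lmul^~ y)) => [a b|]; rewrite ?lmulDl ?lmul0l.
Qed.
Lemma lmul_sumr (I : finType) (F : I -> leavitt) y :
  lmul y (\sum_i F i) = \sum_i lmul y (F i).
Proof.
by apply: (big_morph (lmul y)) => [a b|]; rewrite ?lmulDr ?lmul0r.
Qed.

Lemma lvertex_mul v w :
  lmul (lvertex v) (lvertex w) = if v == w then lvertex v else 0.
Proof.
rewrite -lpi_mul; case: eqP => [<-|/eqP vw]; apply/lpiP; by constructor.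
Qed.

Lemma lone_vertexl v : lmul lone (lvertex v) = lvertex v.
Proof.
rewrite lmul_suml (bigD1 v) //= lvertex_mul eqxx big1 ?addr0 // => w wv.
by rewrite lvertex_mul (negbTE wv).
Qed.
Lemma lone_vertexr v : lmul (lvertex v) lone = lvertex v.
Proof.
rewrite lmul_sumr (bigD1 v) //= lvertex_mul eqxx big1 ?addr0 // => w wv.
by rewrite lvertex_mul eq_sym (negbTE wv).
Qed.

Lemma lone_unit x : lmul lone (lpi x) = lpi x /\ lmul (lpi x) lone = lpi x.
Proof.
elim: x => [v|e|e||x [IH1 IH2]|x [IHx1 IHx2] y [IHy1 IHy2]|a x [IH1 IH2]
           |x [IHx1 IHx2] y [IHy1 IHy2]].
- by rewrite lone_vertexl lone_vertexr.
- have s : lpi (Tedge e) = lmul (lvertex (src e)) (ledge e).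
    by rewrite -lpi_mul; apply/lpiP/lc_sym/lc_E1s.
  have r : lpi (Tedge e) = lmul (ledge e) (lvertex (rng e)).
    by rewrite -lpi_mul; apply/lpiP/lc_sym/lc_E1r.
  by split; [rewrite s lmulA lone_vertexl | rewrite r -lmulA lone_vertexr].
- have r : lpi (Tghost e) = lmul (lvertex (rng e)) (lghost e).
    by rewrite -lpi_mul; apply/lpiP/lc_sym/lc_E2r.
  have s : lpi (Tghost e) = lmul (lghost e) (lvertex (src e)).
    by rewrite -lpi_mul; apply/lpiP/lc_sym/lc_E2s.
  by split; [rewrite r lmulA lone_vertexl | rewrite s -lmulA lone_vertexr].
- by rewrite lmul0l lmul0r.
- rewrite lpi_opp -[lopp _]/(- (lpi x)) -scaleN1r.
  by rewrite -lscale_mulr -lscale_mull IH1 IH2.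
- rewrite lpi_add -[ladd _ _]/(lpi x + lpi y).
  by rewrite lmulDl lmulDr IHx1 IHx2 IHy1 IHy2.
- rewrite lpi_scale -[lscale _ _]/(a *: lpi x).
  by rewrite -lscale_mulr -lscale_mull IH1 IH2.
- by rewrite lpi_mul lmulA IHx1 -lmulA IHy2.
Qed.

Lemma lmul1l : left_id lone lmul.
Proof. by move=> x; rewrite -(lreprK x); case: (lone_unit (repr x)). Qed.
Lemma lmul1r : right_id lone lmul.
Proof. by move=> x; rewrite -(lreprK x); case: (lone_unit (repr x)). Qed.

(* Only a pzRingType: for the empty graph the algebra is trivial. *)
HB.instance Definition _ :=
  GRing.Zmodule_isPzRing.Build leavitt lmulA lmul1l lmul1r lmulDl lmulDr.

Lemma leavitt_scalerAl a (x y : leavitt) : a *: (x * y) = (a *: x) * y.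
Proof. exact: lscale_mull. Qed.
Lemma leavitt_scalerAr a (x y : leavitt) : a *: (x * y) = x * (a *: y).
Proof. exact: lscale_mulr. Qed.

End Presentation.

Local Open Scope classical_set_scope.

Section Ideals.
Variables (K : fieldType) (E : fin_digraph).
Local Notation L := (leavitt K E).

Definition is_ideal (I : set L) : Prop :=
  [/\ I 0, forall x y, I x -> I y -> I (x + y),
      forall (a : K) x, I x -> I (a *: x)
    & forall x y, I y -> I (x * y) /\ I (y * x)].

Definition ideal_gen (G : set L) : set L := smallest is_ideal G.

Definition path_elt (p : seq (edge E)) : L := \prod_(e <- p) ledge K e.

(* The zeroth power is the base vertex, not the identity of the algebra. *)
Definition lambda_pow (v : vertex E) (p : seq (edge E)) (i : nat) : L :=
  if i is 0 then lvertex K v else path_elt p ^+ i.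

Definition lambda_coefs (a : {poly K}) : Prop :=
  (2 <= count (fun c : K => c != 0%R) a)%N /\ a`_0 != 0.

Definition lambda_eval (v : vertex E) (p : seq (edge E)) (a : {poly K}) : L :=
  \sum_(i < size a) a`_i *: lambda_pow v p i.

Definition lambda_reducible (I : set L) : Prop :=
  exists (A : Type) (v : A -> vertex E) (lam : A -> seq (edge E))
         (p : A -> {poly K}) (X : {set vertex E}),
    [/\ forall a, K1_cycle (v a) (lam a) /\ lambda_coefs (p a),
        hereditary X, saturated X
      & I = ideal_gen ([set x | exists a, x = lambda_eval (v a) (lam a) (p a)]
               `|` [set x | exists2 w, w \in X & x = lvertex K w])].

Definition lambda_ideal := {I : set L | lambda_reducible I}.

Definition lambda_le (I J : lambda_ideal) : Prop := sval I `<=` sval J.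

End Ideals.

Definition is_lattice (T : Type) (le : T -> T -> Prop) : Prop :=
  [/\ forall x, le x x,
      forall x y, le x y -> le y x -> x = y,
      forall x y z, le x y -> le y z -> le x z,
      forall x y, exists m, [/\ le m x, le m y &
                             forall z, le z x -> le z y -> le z m]
    & forall x y, exists j, [/\ le x j, le y j &
                             forall z, le x z -> le y z -> le j z]].

Definition order_iso (T U : Type) (leT : T -> T -> Prop) (leU : U -> U -> Prop)
    : Prop :=
  exists f : T -> U, bijective f /\ forall x y, leT x y <-> leU (f x) (f y).

(* In each gen_X the constructors are exactly the displayed containments,
   including the ones between two members of the same family. *)
Section Forms.
Variable K : fieldType.

Definition Qpoly :=
  {p : {poly K} | [&& p \is monic, (2 <= size p)%N & p`_0 != 0]}.

Definition qdvd (p q : Qpoly) : bool := sval p %| sval q.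

Inductive elt_I := I_0 | I_L.
Inductive gen_I : elt_I -> elt_I -> Prop :=
  | gI_0L : gen_I I_0 I_L.

Inductive elt_II := II_0 | II_p of Qpoly | II_L.
Inductive gen_II : elt_II -> elt_II -> Prop :=
  | gII_0p p : gen_II II_0 (II_p p)
  | gII_pp p p' : qdvd p' p -> gen_II (II_p p) (II_p p')
  | gII_pL p : gen_II (II_p p) II_L.

Inductive elt_III := III_0 | III_v | III_p of Qpoly | III_L.
Inductive gen_III : elt_III -> elt_III -> Prop :=
  | gIII_0v : gen_III III_0 III_v
  | gIII_vp p : gen_III III_v (III_p p)
  | gIII_pp p p' : qdvd p' p -> gen_III (III_p p) (III_p p')
  | gIII_pL p : gen_III (III_p p) III_L.

Inductive elt_IV := IV_0 | IV_pf of Qpoly | IV_v | IV_qe of Qpoly | IV_L.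
Inductive gen_IV : elt_IV -> elt_IV -> Prop :=
  | gIV_0p p : gen_IV IV_0 (IV_pf p)
  | gIV_pp p p' : qdvd p' p -> gen_IV (IV_pf p) (IV_pf p')
  | gIV_pv p : gen_IV (IV_pf p) IV_v
  | gIV_vq q : gen_IV IV_v (IV_qe q)
  | gIV_qq q q' : qdvd q' q -> gen_IV (IV_qe q) (IV_qe q')
  | gIV_qL q : gen_IV (IV_qe q) IV_L.

Inductive elt_V := V_0 | V_v | V_L.
Inductive gen_V : elt_V -> elt_V -> Prop :=
  | gV_0v : gen_V V_0 V_v
  | gV_vL : gen_V V_v V_L.

Inductive elt_VI := VI_0 | VI_p of Qpoly | VI_v | VI_L.
Inductive gen_VI : elt_VI -> elt_VI -> Prop :=
  | gVI_0p p : gen_VI VI_0 (VI_p p)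
  | gVI_pp p p' : qdvd p' p -> gen_VI (VI_p p) (VI_p p')
  | gVI_pv p : gen_VI (VI_p p) VI_v
  | gVI_vL : gen_VI VI_v VI_L.

Inductive elt_VII := VII_0 | VII_u | VII_v | VII_L.
Inductive gen_VII : elt_VII -> elt_VII -> Prop :=
  | gVII_0u : gen_VII VII_0 VII_u
  | gVII_uL : gen_VII VII_u VII_L
  | gVII_0v : gen_VII VII_0 VII_v
  | gVII_vL : gen_VII VII_v VII_L.

Inductive elt_VIII :=
  VIII_0 | VIII_p of Qpoly | VIII_u | VIII_v | VIII_pv of Qpoly | VIII_L.
Inductive gen_VIII : elt_VIII -> elt_VIII -> Prop :=
  | gVIII_0p p : gen_VIII VIII_0 (VIII_p p)
  | gVIII_pu p : gen_VIII (VIII_p p) VIII_u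
  | gVIII_uL : gen_VIII VIII_u VIII_L
  | gVIII_0v : gen_VIII VIII_0 VIII_v
  | gVIII_vpv p : gen_VIII VIII_v (VIII_pv p)
  | gVIII_pvL p : gen_VIII (VIII_pv p) VIII_L
  | gVIII_pp p p' : qdvd p' p -> gen_VIII (VIII_p p) (VIII_p p')
  | gVIII_pvpv p p' : qdvd p' p -> gen_VIII (VIII_pv p) (VIII_pv p')
  | gVIII_ppv p p' : qdvd p' p -> gen_VIII (VIII_p p) (VIII_pv p').

Inductive elt_IX :=
  | IX_0 | IX_p of Qpoly | IX_q of Qpoly | IX_pq of Qpoly & Qpoly
  | IX_u | IX_v | IX_pv of Qpoly | IX_uq of Qpoly | IX_L.
Inductive gen_IX : elt_IX -> elt_IX -> Prop :=
  | gIX_0p p : gen_IX IX_0 (IX_p p)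
  | gIX_pu p : gen_IX (IX_p p) IX_u
  | gIX_uuq q : gen_IX IX_u (IX_uq q)
  | gIX_uqL q : gen_IX (IX_uq q) IX_L
  | gIX_0q q : gen_IX IX_0 (IX_q q)
  | gIX_qv q : gen_IX (IX_q q) IX_v
  | gIX_vpv p : gen_IX IX_v (IX_pv p)
  | gIX_pvL p : gen_IX (IX_pv p) IX_L
  | gIX_pp p p' : qdvd p' p -> gen_IX (IX_p p) (IX_p p')
  | gIX_qq q q' : qdvd q' q -> gen_IX (IX_q q) (IX_q q')
  | gIX_pqpq p p' q q' :
      qdvd p' p -> qdvd q' q -> gen_IX (IX_pq p q) (IX_pq p' q')
  | gIX_pvpv p p' : qdvd p' p -> gen_IX (IX_pv p) (IX_pv p')
  | gIX_uquq q q' : qdvd q' q -> gen_IX (IX_uq q) (IX_uq q')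
  | gIX_ppq p p' q : qdvd p' p -> gen_IX (IX_p p) (IX_pq p' q)
  | gIX_qpq p q q' : qdvd q' q -> gen_IX (IX_q q) (IX_pq p q')
  | gIX_pqpv p p' q : qdvd p' p -> gen_IX (IX_pq p q) (IX_pv p')
  | gIX_pquq p q q' : qdvd q' q -> gen_IX (IX_pq p q) (IX_uq q').

Inductive lattice_form := FI | FII | FIII | FIV | FV | FVI | FVII | FVIII | FIX.

Definition form_elt (i : lattice_form) : Type :=
  match i with
  | FI => elt_I | FII => elt_II | FIII => elt_III
  | FIV => elt_IV | FV => elt_V | FVI => elt_VI
  | FVII => elt_VII | FVIII => elt_VIII | FIX => elt_IX
  end.

Definition form_gen (i : lattice_form) : form_elt i -> form_elt i -> Prop :=
  match i with
  | FI => gen_I | FII => gen_II | FIII => gen_III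
  | FIV => gen_IV | FV => gen_V | FVI => gen_VI
  | FVII => gen_VII | FVIII => gen_VIII | FIX => gen_IX
  end.

Definition form_le (i : lattice_form) : form_elt i -> form_elt i -> Prop :=
  clos_refl_trans (form_elt i) (@form_gen i).

End Forms.

Arguments form_le : clear implicits.

(* Main.v *)
(* To an ideal [I] and a vertex [w] attach the set of polynomials [p] with
   [p(lambda_w)] in [I] when [w] is K1 (constant polynomials otherwise).  Since
   the cycle acts invertibly in the corner at [w], this set is the trace of an
   ideal of Laurent polynomials, so it is generated by a unique [g w] which is 0
   or monic with nonzero constant term.  A lambda-reducible ideal is generated by
   the [g w (lambda_w)], hence inclusion is reverse divisibility at each vertex.
   Which pairs [(g u, g v)] occur depends only on the shape of the graph: all of
   them (no edge between [u] and [v]), those with [g u = 0] or [g v = 1] (an edge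
   from [u] to [v] and a loop at [u]), or a single free coordinate.  That no
   other relations hold is seen on a representation of the algebra by functions
   on [vertex * nat]: the edges leaving a vertex act by the residue classes
   [m |-> m * d + i], and one edge of the cycle is twisted by the companion matrix
   of [g], so that the kernel contains [p(lambda)] exactly when [g] divides [p]. *)
Require Import Defs.
From mathcomp Require Import all_boot all_algebra.

Set Implicit Arguments.
Unset Strict Implicit.
Unset Printing Implicit Defensive.

Import GRing.Theory.
Local Open Scope ring_scope.

(** * Representations on functions *)

(** The algebra is given by a presentation: membership in an ideal is shown by computing, but
    non-membership needs a model. The representation therefore carries a hereditary saturated set
    [X] of vertices that act as zero; killing the other vertex, or none, isolates one vertex [w], so
    that every other generator vanishes. A [K1] vertex has no second way of returning, so the exits
    of its cycle are made to end in [X]; what is left of the cycle has one outgoing edge at each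
    step, and residues modulo 1 disappear. A zero generator needs no separate model: matrices of
    growing size suffice. Meets and joins are never computed in the algebra. They are least common
    multiples and gcds on pairs, carried over by the isomorphism. Since the field may have only two
    elements, the nine forms are separated using only ['X - 1], products and [p * 'X + 1], which
    give members of [Qpoly] over every field. *)

Section Representation.
Variables (K : fieldType) (E : fin_digraph) (X : {set vertex E}).
Hypotheses (hX : hereditary X) (sX : saturated X).
Variables (n : nat) (M : 'M[K]_n.+1) (w0 : vertex E).
Hypothesis uM : M \in unitmx.

(** An edge into [X] must act as zero along with its range. Since [X] is hereditary, a live edge
    also has its source outside [X]. *)
Definition live (e : edge E) := rng e \notin X.
Definition live_out (v : vertex E) : {set edge E} :=
  [set e | (src e == v) && live e].
Definition deg (v : vertex E) := #|live_out v|.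
Definition rank (e : edge E) := index e (enum (live_out (src e))).
(** Every edge leaving [w0] is twisted, but a closed simple path based at [w0] leaves [w0] only
    once, so one turn multiplies by [M] exactly once. *)
Definition weight (e : edge E) := if src e == w0 then M else 1%:M.
Definition weightV (e : edge E) := if src e == w0 then invmx M else 1%:M.

Definition rep_space := vertex E -> nat -> 'rV[K]_n.+1.

Definition vertex_op (v : vertex E) (f : rep_space) : rep_space := fun w m =>
  if (w == v) && (v \notin X) then f w m else 0.
(** For a live edge, [edge_op] and [ghost_op] are mutually inverse between the functions at [rng e]
    and those at [src e] supported on one residue class. Disjointness of the classes gives (CK1),
    and (CK2) holds because they cover all naturals. *)
Definition edge_op (e : edge E) (f : rep_space) : rep_space := fun w m =>
  if [&& live e, w == src e & m %% deg w == rank e]%N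
  then f (rng e) (m %/ deg w)%N *m weight e else 0.
Definition ghost_op (e : edge E) (f : rep_space) : rep_space := fun w m =>
  if live e && (w == rng e)
  then f (src e) (m * deg (src e) + rank e)%N *m weightV e else 0.

Fixpoint den (t : lterm K E) (f : rep_space) : rep_space :=
  match t with
  | Tvertex v => vertex_op v f
  | Tedge e => edge_op e f
  | Tghost e => ghost_op e f
  | Tzero => fun _ _ => 0
  | Topp x => fun w m => - den x f w m
  | Tadd x y => fun w m => den x f w m + den y f w m
  | Tscale a x => fun w m => a *: den x f w m
  | Tmul x y => den x (den y f)
  end.

(** Operators are bare functions, so linearity is proved by induction on terms. It is what makes the
    distributivity and scaling clauses of the congruence sound. *)
Lemma den_linear t a (f g : rep_space) :
  den t (fun w m => a *: f w m + g w m) =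
  (fun w m => a *: den t f w m + den t g w m).
Proof.
elim: t f g => [v|e|e||x IH|x IHx y IHy|b x IH|x IHx y IHy] f g /=;
  apply/funext => w; apply/funext => m.
- by rewrite /vertex_op; case: ifP => // _; rewrite scaler0 addr0.
- rewrite /edge_op; case: ifP => // _; last by rewrite scaler0 addr0.
  by rewrite mulmxDl scalemxAl.
- rewrite /ghost_op; case: ifP => // _; last by rewrite scaler0 addr0.
  by rewrite mulmxDl scalemxAl.
- by rewrite scaler0 addr0.
- by rewrite IH opprD scalerN.
- by rewrite IHx IHy scalerDr addrACA.
- by rewrite IH scalerDr !scalerA mulrC.
- by rewrite IHy IHx.
Qed.

Lemma rep_ext (f g : rep_space) : (forall w m, f w m = g w m) -> f = g.
Proof. by move=> fg; apply/funext => w; apply/funext. Qed.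

Lemma den_add t (f g : rep_space) :
  den t (fun w m => f w m + g w m) = (fun w m => den t f w m + den t g w m).
Proof.
have -> : (fun w m => f w m + g w m) = (fun w m => 1 *: f w m + g w m).
  by apply: rep_ext => w m; rewrite scale1r.
by rewrite den_linear; apply: rep_ext => w m; rewrite scale1r.
Qed.

Lemma den_zero t : den t (fun _ _ => 0) = fun _ _ => 0.
Proof.
have {1}-> : (fun _ _ => 0) = (fun _ _ => -1 *: 0 + 0) :> rep_space.
  by apply: rep_ext => w m; rewrite scaler0 addr0.
by rewrite den_linear; apply: rep_ext => w m; rewrite scaleN1r addNr.
Qed.

Lemma den_scale t a (f : rep_space) :
  den t (fun w m => a *: f w m) = (fun w m => a *: den t f w m).
Proof.
have -> : (fun w m => a *: f w m) = (fun w m => a *: f w m + 0) :> rep_space.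
  by apply: rep_ext => w m; rewrite addr0.
by rewrite den_linear den_zero; apply: rep_ext => w m; rewrite addr0.
Qed.

Lemma live_src e : live e -> src e \notin X.
Proof.
apply: contraNN => /hX h; apply: h; exists [:: e].
by rewrite /= !eqxx.
Qed.

Lemma rank_deg e : live e -> (rank e < deg (src e))%N.
Proof. by move=> le; rewrite /deg cardE index_mem mem_enum inE eqxx. Qed.

Lemma rank_inj e f : live e -> live f -> src e = src f -> rank e = rank f -> e = f.
Proof.
move=> le lf s; rewrite /rank -s => r.
have ef : e \in enum (live_out (src e)) by rewrite mem_enum inE eqxx.
have ff : f \in enum (live_out (src e)) by rewrite mem_enum inE s eqxx.
by rewrite -(nth_index e ef) r nth_index.
Qed.

Lemma rank_surj v i : (i < deg v)%N -> exists e, [/\ live e, src e = v & rank e = i].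
Proof.
rewrite /deg cardE => lti.
case: (set_0Vmem (live_out v)) => [E0|[e0 _]].
  by rewrite E0 enum_set0 in lti.
have := mem_nth e0 lti; rewrite mem_enum inE => /andP[/eqP s l].
exists (nth e0 (enum (live_out v)) i); split=> //.
by rewrite /rank s index_uniq ?enum_uniq.
Qed.

Lemma weightK e : weight e *m weightV e = 1%:M.
Proof. by rewrite /weight /weightV; case: ifP => _; rewrite ?mulmxV ?mulmx1. Qed.
Lemma weightVK e : weightV e *m weight e = 1%:M.
Proof. by rewrite /weight /weightV; case: ifP => _; rewrite ?mulVmx ?mulmx1. Qed.

Lemma den_cong x y : lcong x y -> den x = den y.
Proof.
have fe (F G : rep_space -> rep_space) :
    (forall f w m, F f w m = G f w m) -> F = G.
  by move=> FG; apply/funext => f; apply/funext => w; apply/funext.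
elim=> //=.
- by move=> ? ? ? _ -> _ ->.
- by move=> ? ? _ ->.
- by move=> ? ? ? ? _ -> _ ->.
- by move=> ? ? ? _ ->.
- by move=> ? ? ? ? _ -> _ ->.
- by move=> *; apply: fe => *; rewrite addrA.
- by move=> *; apply: fe => *; rewrite addrC.
- by move=> *; apply: fe => *; rewrite add0r.
- by move=> *; apply: fe => *; rewrite addNr.
- by move=> *; apply: fe => *; rewrite scalerA.
- by move=> *; apply: fe => *; rewrite scale1r.
- by move=> *; apply: fe => *; rewrite scalerDr.
- by move=> *; apply: fe => *; rewrite scalerDl.
- by move=> *; apply: fe => *; rewrite den_add.
- by move=> *; apply: fe => *; rewrite den_scale.
- move=> v w vw; apply: fe => f z m; rewrite /vertex_op.
  by case: (z =P v) => [->|] //=; rewrite (negbTE vw) /= if_same.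
- by move=> v; apply: fe => f z m; rewrite /vertex_op; case: ifP => // ->.
- move=> e; apply: fe => f z m; rewrite /edge_op /vertex_op.
  by case: ifP => // /and3P[le _ _]; rewrite eqxx -/(live e) le.
- move=> e; apply: fe => f z m; rewrite /edge_op /vertex_op.
  case: ifP => [//|]; case: ifP => // /and3P[le /eqP zs _].
  by rewrite zs eqxx live_src.
- move=> e; apply: fe => f z m; rewrite /ghost_op /vertex_op.
  by case: ifP => // /andP[le _]; rewrite eqxx live_src.
- move=> e; apply: fe => f z m; rewrite /ghost_op /vertex_op.
  case: ifP => [//|]; case: ifP => // /andP[le /eqP zs].
  by rewrite zs eqxx -/(live e) le.
- move=> e g eg; apply: fe => f z m; rewrite /ghost_op /edge_op.
  case: ifP => // /andP[le _]; case: ifP => [|_]; last by rewrite mul0mx.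
  case/and3P=> lg /eqP s; rewrite modnMDl modn_small ?rank_deg // => /eqP r.
  by case/eqP: eg; apply: rank_inj.
- move=> e; apply: fe => f z m; rewrite /ghost_op /edge_op /vertex_op.
  rewrite -/(live e) andbC; case: ifP => // /andP[/eqP-> le].
  have d0 : (0 < deg (src e))%N by apply: leq_ltn_trans (rank_deg le).
  rewrite le eqxx modnMDl modn_small ?rank_deg // eqxx /=.
  by rewrite divnMDl // divn_small ?rank_deg // addn0 -mulmxA weightK mulmx1.
- move=> v vE; apply: fe => f z m.
  have -> : den (\big[Tadd (E:=E)/Tzero K E]_(e | src e == v)
       Tmul (Tedge K e) (Tghost K e)) f z m =
       \sum_(e | src e == v) edge_op e (ghost_op e f) z m.
    by elim/big_rec2: _ => [|e a b _ /= ->].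
  rewrite /vertex_op; case: ifP => [/andP[/eqP-> vX]|nv].
    (* Were every edge leaving [v] to end in [X], saturation would put [v] in [X]. The remainder of
       [m] then selects the only edge that contributes to the sum. *)
    have d0 : (0 < deg v)%N.
      rewrite lt0n cards_eq0; apply/negP => /eqP d0.
      case/negP: vX; apply: sX => // e ev; apply/negPn/negP => le.
      by move/setP/(_ e): d0; rewrite !inE ev eqxx /live le.
    have [e [le ev r]] := rank_surj (ltn_pmod m d0).
    rewrite (bigD1 e) ?ev //= big1 ?addr0.
      rewrite /edge_op /ghost_op le ev r !eqxx /=.
      by rewrite -mulmxA weightVK mulmx1 -divn_eq.
    move=> g /andP[/eqP gv ge]; rewrite /edge_op; case: ifP => // /and3P[lg _].
    by rewrite -r => /eqP rg; case/eqP: ge; apply: rank_inj; rewrite ?gv ?ev.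
  rewrite big1 // => e /eqP ev; rewrite /edge_op.
  case: ifP => // /and3P[le /eqP zs _].
  by move: nv; rewrite zs ev eqxx -ev live_src.
Qed.

Definition rho (x : leavitt K E) := den (repr x).

Lemma rho_pi t : rho (lpi t) = den t.
Proof. exact/den_cong/lrepr_pi. Qed.

Lemma rho_mul x y f : rho (x * y) f = rho x (rho y f).
Proof. by rewrite /GRing.mul /= rho_pi. Qed.

Lemma rho_add x y f w m : rho (x + y) f w m = rho x f w m + rho y f w m.
Proof. by rewrite {1}/GRing.add /= rho_pi. Qed.

Lemma rho_scale a x f w m : rho (a *: x) f w m = a *: rho x f w m.
Proof. by rewrite {1}/GRing.scale /= rho_pi. Qed.

Lemma rho0 f w m : rho 0 f w m = 0.
Proof. by rewrite rho_pi. Qed.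

Lemma rho_sum (I : Type) (r : seq I) (F : I -> leavitt K E) f w m :
  rho (\sum_(i <- r) F i) f w m = \sum_(i <- r) rho (F i) f w m.
Proof.
elim: r => [|i r IH]; first by rewrite !big_nil rho0.
by rewrite !big_cons rho_add IH.
Qed.

Lemma rho_lvertex v : rho (lvertex K v) = vertex_op v.
Proof. exact: rho_pi. Qed.

Lemma rho1 f w m : rho 1 f w m = if w \notin X then f w m else 0.
Proof.
rewrite (_ : 1 = lone K E) // /lone rho_sum (bigD1 w) //= big1 ?addr0.
  by rewrite rho_lvertex /vertex_op eqxx.
by move=> v vw; rewrite rho_lvertex /vertex_op eq_sym (negbTE vw).
Qed.

Definition rep_ker : set (leavitt K E) :=
  [set x | forall f w m, rho x f w m = 0].

Lemma rep_ker_ideal : is_ideal rep_ker.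
Proof.
split=> [f w m|x y Ix Iy f w m|a x Ix f w m|x y Iy].
- exact: rho0.
- by rewrite rho_add Ix Iy addr0.
- by rewrite rho_scale Ix scaler0.
split=> f w m; rewrite rho_mul; last exact: Iy.
suff -> : rho y f = fun _ _ => 0 by rewrite /rho den_zero.
by apply/funext => v; apply/funext => k; apply: Iy.
Qed.

Lemma rep_ker_vertex v : rep_ker (lvertex K v) <-> v \in X.
Proof.
split=> [/(_ (fun _ _ => const_mx 1) v 0%N)|vX f w m]; rewrite rho_lvertex /vertex_op.
  rewrite eqxx; case: (v \in X) => //= /matrixP/(_ ord0 ord0).
  by rewrite !mxE => /eqP; rewrite oner_eq0.
by rewrite vX andbF.
Qed.

Definition exitless (p : seq (edge E)) :=
  forall e, e \in p -> live e /\
    forall e', src e' = src e -> live e' -> e' = e.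

(** With a single live edge the degree is 1 and the rank 0, so division leaves the index [m]
    unchanged. *)
Lemma rho_edge e : live e -> (forall e', src e' = src e -> live e' -> e' = e) ->
  forall f m, rho (ledge K e) f (src e) m = f (rng e) m *m weight e.
Proof.
move=> le ue f m; rewrite rho_pi /= /edge_op le eqxx /=.
have d1 : live_out (src e) = [set e].
  apply/setP => e'; rewrite !inE; apply/andP/eqP => [[/eqP s l]|->//].
  exact: ue.
have -> : deg (src e) = 1%N by rewrite /deg d1 cards1.
by rewrite /rank d1 enum_set1 /= eqxx modn1 divn1.
Qed.

Lemma rho_path p v w : v \notin X -> walk v p w -> exitless p ->
  {in p, forall e, src e != w0} ->
  forall f m, rho (path_elt K p) f v m = f w m.
Proof.
move=> + + + + f m; elim: p v => [|e p IH] v vX /=.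
  by move=> /eqP<- _ _; rewrite /path_elt big_nil rho1 vX.
move=> /andP[/eqP ev wp] xp sp; have [le ue] := xp e (mem_head _ _).
rewrite /path_elt big_cons -/(path_elt K p) rho_mul -ev rho_edge //.
rewrite IH //; last 2 first.
- by move=> e' e'p; apply: xp; rewrite inE e'p orbT.
- by move=> e' e'p; apply: sp; rewrite inE e'p orbT.
by rewrite /weight (negbTE (sp _ (mem_head _ _))) mulmx1.
Qed.

Variable lam : seq (edge E).
Hypotheses (lamP : closed_simple_path w0 lam) (xlam : exitless lam).

Lemma rho_cycle f m : rho (path_elt K lam) f w0 m = f w0 m *m M.
Proof.
case: lam lamP xlam => [|e p] //= /and3P[_ /= /andP[/eqP ev wp] /allP sp] xp.
have [le ue] := xp e (mem_head _ _).
rewrite /path_elt big_cons -/(path_elt K p) rho_mul -ev rho_edge //.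
rewrite (rho_path _ wp) ?ev //; last by move=> e' e'p; apply: xp; rewrite inE e'p orbT.
by rewrite /weight ev eqxx.
Qed.

Lemma w0X : w0 \notin X.
Proof.
case: lam lamP xlam => [|e p] //= /and3P[_ /= /andP[/eqP <- _] _] xp.
by case: (xp e (mem_head _ _)) => /live_src.
Qed.

Lemma rho_lambda_pow f i m : rho (lambda_pow K w0 lam i) f w0 m = f w0 m *m M ^+ i.
Proof.
case: i => [|i] /=; first by rewrite rho_lvertex /vertex_op eqxx w0X mulmx1.
elim: i f m => [|i IH] f m; first by rewrite !expr1 rho_cycle.
by rewrite exprS rho_mul rho_cycle IH -mulmxA [in RHS]exprSr.
Qed.

(** At [w0] the element acts as right multiplication by the value of [p] at [M]. Testing on the
    basis rows recovers this whole matrix. *)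
Lemma rep_ker_lambda (p : {poly K}) :
  rep_ker (lambda_eval w0 lam p) <-> horner_mx M p = 0.
Proof.
have ev f m : rho (lambda_eval w0 lam p) f w0 m = f w0 m *m horner_mx M p.
  rewrite /lambda_eval rho_sum.
  transitivity (f w0 m *m (\sum_(i < size p) p`_i *: M ^+ i)).
    rewrite mulmx_sumr; apply: eq_bigr => i _.
    by rewrite rho_scale rho_lambda_pow scalemxAr.
  congr (_ *m _); rewrite [in RHS](_ : p = \sum_(i < size p) p`_i *: 'X^i).
    rewrite raddf_sum /=; apply: eq_bigr => i _.
    by rewrite linearZ /= rmorphXn /= horner_mx_X.
  by rewrite -[LHS]coefK poly_def.
split=> [N|p0 f w m].
  apply/row_matrixP => i; rewrite row0 rowE.
  by rewrite -(ev (fun _ _ => delta_mx 0 i) 0%N) N.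
(* The vertex in front makes the values away from [w0] vanish. *)
have -> : lambda_eval w0 lam p = lvertex K w0 * lambda_eval w0 lam p.
  rewrite /lambda_eval mulr_sumr; apply: eq_bigr => i _.
  rewrite -leavitt_scalerAr; congr (_ *: _).
  case: (nat_of_ord i) => [|k] /=; first by rewrite [RHS]lvertex_mul eqxx.
  rewrite exprS mulrA; congr (_ * _).
  case: lam lamP => [|e q] //= /and3P[_ /= /andP[/eqP <- _] _].
  rewrite /path_elt big_cons mulrA; congr (_ * _).
  by rewrite -[RHS]lpi_mul; apply/lpiP/lc_sym/lc_E1s.
rewrite rho_mul rho_lvertex /vertex_op; case: ifP => // /andP[/eqP -> _].
by rewrite ev p0 mulmx0.
Qed.

End Representation.

(** * Evaluation at closed simple paths *)

(** The matrix is invertible because its determinant is the constant coefficient of [g] up to sign.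
    The first basis row is cyclic: powers of [M] move it through all the basis rows, so a remainder
    modulo [g] that kills it has only zero coefficients. *)
Lemma companion_unitmx (K : fieldType) (g : {poly K}) :
  g \is monic -> (1 < size g)%N -> g`_0 != 0 ->
  exists n (M : 'M[K]_n.+1), M \in unitmx /\
    forall p, horner_mx M p = 0 <-> g %| p.
Proof.
move=> gm g1 g0; have gM := companionmxK gm.
have [n Dn] : exists n, (size g).-1 = n.+1 by exists (size g).-2; case: (size g) g1 => [|[]].
move: (companionmx g) gM (@mulmx_delta_companion _ g); rewrite Dn => M gM shift.
have pows i (lti : (i < n.+1)%N) : delta_mx 0 0 *m M ^+ i = delta_mx 0 (Ordinal lti) :> 'rV_n.+1.
  elim: i lti => [|i IH] lti; first by rewrite mulmx1; congr delta_mx; apply: val_inj.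
  rewrite exprSr mulmxA (IH (ltnW lti)) shift; congr delta_mx; exact: val_inj.
exists n, M; split=> [|p].
  rewrite unitmxE unitfE; move: g0; rewrite -gM char_poly_det.
  by rewrite mulf_eq0 negb_or => /andP[].
have CH : horner_mx M g = 0 by rewrite -{1}gM Cayley_Hamilton.
split=> [|/dvdpP[q ->]]; last by rewrite rmorphM /= CH mulr0.
rewrite {1}(divp_eq p g) rmorphD rmorphM /= CH mulr0 add0r => r0.
apply/modp_eq0P; set r := p %% g in r0 *.
have szr : (size r <= n.+1)%N.
  by rewrite -ltnS -Dn prednK ?(ltnW g1) // ltn_modp monic_neq0.
have {r0} : delta_mx 0 0 *m horner_mx M r = 0 :> 'rV_n.+1 by rewrite r0 mulmx0.
rewrite [r in horner_mx M r](_ : r = \sum_(i < n.+1) r`_i *: 'X^i); last first.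
  rewrite -poly_def; apply/polyP => i; rewrite coef_poly.
  by case: ltnP => // /(leq_trans szr)/(nth_default 0).
rewrite raddf_sum /= mulmx_sumr => r0; apply/polyP => i; rewrite coef0.
case: (ltnP i n.+1) => [lti|/(leq_trans szr)/(nth_default 0)//].
move/matrixP/(_ 0 (Ordinal lti)): r0; rewrite summxE mxE.
rewrite (bigD1 (Ordinal lti)) //= big1 ?addr0 => [|j ji];
  rewrite linearZ /= rmorphXn /= horner_mx_X -scalemxAr pows !mxE.
  by rewrite !eqxx mulr1.
by move: ji; rewrite -!val_eqE /= eq_sym => /negbTE->; rewrite mulr0.
Qed.

(** * Normalised generators of ideals of Laurent polynomials *)

Definition normal_gen (K : fieldType) (g : {poly K}) : bool :=
  (g == 0) || (g \is monic) && (g`_0 != 0).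

Lemma normal_gen0 (K : fieldType) : normal_gen (0 : {poly K}).
Proof. by rewrite /normal_gen eqxx. Qed.
Lemma normal_gen1 (K : fieldType) : normal_gen (1 : {poly K}).
Proof. by apply/orP; right; rewrite monic1 coef1 oner_eq0. Qed.

Lemma normal_gen_antisym (K : fieldType) (g h : {poly K}) :
  normal_gen g -> normal_gen h -> g %| h -> h %| g -> g = h.
Proof.
case/orP=> [/eqP->|/andP[gm _]] hh gh hg.
  by apply/esym/eqP; rewrite -dvd0p.
case/orP: hh gh hg => [/eqP->|/andP[hm _]] gh hg.
  by apply/eqP; rewrite -dvd0p.
by apply/eqP; rewrite -eqp_monic // /eqp gh.
Qed.

Lemma normal_gen_dvdMX (K : fieldType) (g p : {poly K}) :
  normal_gen g -> g %| p * 'X -> g %| p.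
Proof.
case/orP=> [/eqP->|/andP[_ g0]]; first by rewrite !dvd0p mulf_eq0 polyX_eq0 orbF.
rewrite Gauss_dvdpl // -['X]subr0 -[0]/(0%:P) coprimep_XsubC.
by rewrite /root horner_coef0.
Qed.

(* The last hypothesis says that [J] is the trace of an ideal of Laurent polynomials. *)
Lemma normal_gen_exists (K : fieldType) (J : {poly K} -> Prop) :
  J 0 -> (forall p q, J p -> J q -> J (p + q)) ->
  (forall a p, J p -> J (a *: p)) -> (forall p, J p -> J (p * 'X)) ->
  (forall p, J (p * 'X) -> J p) ->
  exists2 g, normal_gen g & forall p, J p <-> g %| p.
Proof.
move=> J0 JD JZ JX JV.
have JM p q : J p -> J (p * q).
  move=> Jp; elim/poly_ind: q => [|q c IH]; first by rewrite mulr0.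
  by rewrite mulrDr mulrA; apply: JD; [exact: JX | rewrite mulrC mul_polyC; exact: JZ].
case: (pselect (exists2 p, J p & p != 0)) => [[p Jp p0]|noJ]; last first.
  exists 0 => [|p]; first exact: normal_gen0.
  rewrite dvd0p; split=> [Jp|/eqP->//]; apply: contrapT => /negP p0.
  by apply: noJ; exists p.
pose P k := `[< exists q, [/\ J q, q != 0 & size q = k] >].
have exP : exists k, P k by exists (size p); apply/asboolP; exists p.
case: (ex_minnP exP) => k /asboolP[g [Jg g0 <-]] gmin.
have {}gmin q : J q -> (size q < size g)%N -> q = 0.
  move=> Jq; apply: contraTeq => q0; rewrite -leqNgt; apply: gmin.
  by apply/asboolP; exists q.
have lg0 : lead_coef g != 0 by rewrite lead_coef_eq0.
exists ((lead_coef g)^-1 *: g) => [|q].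
  apply/orP; right; apply/andP; split.
    by rewrite monicE lead_coefZ mulVf.
  rewrite coefZ mulf_neq0 ?invr_eq0 //; apply/negP => /eqP c0.
  (* A vanishing constant term would let the nonzero element of least size be divided by ['X],
     giving a smaller one. *)
  have gX : (g %/ 'X) * 'X = g.
    by apply: divpK; rewrite -['X]subr0 -[0]/(0%:P) dvdp_XsubCl /root horner_coef0 c0.
  have /gmin : J (g %/ 'X) by apply: JV; rewrite gX.
  move=> h; have h0 : g %/ 'X != 0 by apply: contraNneq g0 => h0; rewrite -gX h0 mul0r.
  by case/eqP: (h0); apply: h; rewrite -[X in (_ < size (polyseq X))%N]gX size_mulX.
rewrite dvdpZl ?invr_eq0 //; split=> [Jq|/dvdpP[r ->]]; last by rewrite mulrC; exact: JM.
apply/modp_eq0P/gmin; last by rewrite ltn_modp.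
rewrite (_ : q %% g = q + g * (-1 *: (q %/ g))); first by apply: JD => //; exact: JM.
by rewrite -scalerAr scaleN1r [g * _]mulrC {2}(divp_eq q g) addrAC subrr add0r.
Qed.

Section Evaluation.
Variables (K : fieldType) (E : fin_digraph).
Local Notation L := (leavitt K E).

Lemma ledge_src e : lvertex K (src e) * ledge K e = ledge K e :> L.
Proof. by rewrite -[LHS]lpi_mul; apply/lpiP/lc_E1s. Qed.
Lemma ledge_rng e : ledge K e * lvertex K (rng e) = ledge K e :> L.
Proof. by rewrite -[LHS]lpi_mul; apply/lpiP/lc_E1r. Qed.
Lemma lghost_ledge e f :
  lghost K e * ledge K f = if e == f then lvertex K (rng e) else 0 :> L.
Proof.
by rewrite -[LHS]lpi_mul; case: eqP => [<-|/eqP ef]; apply/lpiP; constructor.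
Qed.
Lemma lvertexM v w :
  lvertex K v * lvertex K w = if v == w then lvertex K v else 0 :> L.
Proof. exact: lvertex_mul. Qed.
Lemma lvertex_CK2 v : (exists e : edge E, src e = v) ->
  lvertex K v = \sum_(e : edge E | src e == v) ledge K e * lghost K e :> L.
Proof.
move=> ve; rewrite /lvertex.
rewrite (_ : lpi _ = lpi (
    \big[@Tadd K E/Tzero K E]_(e : edge E | src e == v) Tmul (Tedge K e) (Tghost K e))).
  by elim/big_rec2: _ => // e x y _ <-; rewrite lpi_add lpi_mul.
exact/lpiP/lc_CK2.
Qed.

Lemma path_elt_cons e p : path_elt K (e :: p) = ledge K e * path_elt K p :> L.
Proof. exact: big_cons. Qed.

Lemma path_elt_src e p w v : walk v (e :: p) w ->
  lvertex K v * path_elt K (e :: p) = path_elt K (e :: p) :> L.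
Proof. by case/andP=> /eqP<- _; rewrite path_elt_cons mulrA ledge_src. Qed.

(** The left inverse is the product of the ghost edges in reverse order. For the empty path
    [path_elt] is 1, and the factor [lvertex K w] turns it into a vertex. *)
Lemma path_elt_cancel v p w : walk v p w ->
  exists y : L, y * (path_elt K p * lvertex K w) = lvertex K w.
Proof.
elim: p v => [|e p IH] v /=.
  by move=> _; exists (lvertex K w); rewrite /path_elt big_nil mul1r lvertexM eqxx.
case/andP=> _ wp; have [y yp] := IH _ wp; exists (y * lghost K e).
rewrite path_elt_cons -(mulrA (ledge K e)) (mulrA _ (ledge K e)) -(mulrA y).
rewrite lghost_ledge eqxx -mulrA mulrA; case: p wp yp {IH} => [/eqP<-|e' p wp].
  by rewrite /path_elt big_nil !mul1r -mulrA lvertexM eqxx.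
by rewrite -mulrA (mulrA (lvertex K (rng e))) (path_elt_src wp).
Qed.

Lemma path_elt_rng v e p w : walk v (e :: p) w ->
  path_elt K (e :: p) * lvertex K w = path_elt K (e :: p) :> L.
Proof.
elim: p v e => [|e' p IH] v e.
  by case/andP=> _ /eqP<-; rewrite path_elt_cons /path_elt big_nil mulr1 ledge_rng.
by case/andP=> _ wp; rewrite path_elt_cons -mulrA (IH _ _ wp).
Qed.

Lemma closed_simple_path_src w l : closed_simple_path w l ->
  lvertex K w * path_elt K l = path_elt K l :> L.
Proof. by case: l => //= e l /and3P[_ + _] => /path_elt_src. Qed.
Lemma closed_simple_path_rng w l : closed_simple_path w l ->
  path_elt K l * lvertex K w = path_elt K l :> L.
Proof. by case: l => //= e l /and3P[_ + _] => /path_elt_rng. Qed.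

Section Lambda.
Variables (w : vertex E) (l : seq (edge E)).
Hypothesis lP : closed_simple_path w l.

Lemma lambda_powE i : lambda_pow K w l i = lvertex K w * path_elt K l ^+ i :> L.
Proof.
case: i => [|i] /=; first by rewrite expr0 mulr1.
by rewrite exprS mulrA closed_simple_path_src.
Qed.

Lemma lambda_eval_widen n (p : {poly K}) : (size p <= n)%N ->
  lambda_eval w l p = \sum_(i < n) p`_i *: lambda_pow K w l i :> L.
Proof.
move=> pn; rewrite /lambda_eval (big_ord_widen _ (fun i => p`_i *: lambda_pow K w l i) pn).
rewrite [RHS](bigID (fun i : 'I_n => (i < size p)%N)) /= [X in _ + X]big1 ?addr0 //.
by move=> i; rewrite -leqNgt => /(nth_default 0) ->; rewrite scale0r.
Qed.

Lemma lambda_evalD p q : lambda_eval w l (p + q) = lambda_eval w l p + lambda_eval w l q :> L.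
Proof.
rewrite (@lambda_eval_widen (maxn (size p) (size q))) ?size_polyD //.
rewrite (@lambda_eval_widen (maxn (size p) (size q)) p) ?leq_maxl //.
rewrite (@lambda_eval_widen (maxn (size p) (size q)) q) ?leq_maxr //.
by rewrite -big_split; apply: eq_bigr => i _; rewrite coefD scalerDl.
Qed.

Lemma lambda_evalZ a p : lambda_eval w l (a *: p) = a *: lambda_eval w l p :> L.
Proof.
rewrite (@lambda_eval_widen (size p)) ?size_scale_leq //.
by rewrite /lambda_eval scaler_sumr; apply: eq_bigr => i _; rewrite coefZ scalerA.
Qed.

Lemma lambda_evalMX p : lambda_eval w l (p * 'X) = lambda_eval w l p * path_elt K l :> L.
Proof.
rewrite (@lambda_eval_widen (size p).+1); last first.
  by apply: leq_trans (size_polyMleq _ _) _; rewrite size_polyX addn2.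
rewrite big_ord_recl coefMX eqxx scale0r add0r /lambda_eval mulr_suml.
apply: eq_bigr => i _; rewrite coefMX /= -leavitt_scalerAl; congr (_ *: _).
by rewrite lambda_powE -mulrA -exprSr exprS mulrA closed_simple_path_src.
Qed.

(** The ghost path is a left inverse of the cycle, so cancelling ['X] inside an ideal needs the
    cycle on the left. *)
Lemma lambda_evalXM p : lambda_eval w l (p * 'X) = path_elt K l * lambda_eval w l p :> L.
Proof.
rewrite lambda_evalMX /lambda_eval mulr_suml mulr_sumr; apply: eq_bigr => i _.
rewrite -leavitt_scalerAr -leavitt_scalerAl lambda_powE; congr (_ *: _).
by rewrite -mulrA -exprSr exprS !mulrA closed_simple_path_rng // closed_simple_path_src.
Qed.

Lemma lambda_evalC c : lambda_eval w l c%:P = c *: lvertex K w :> L.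
Proof.
rewrite (@lambda_eval_widen 1) ?size_polyC ?leq_b1 //.
by rewrite big_ord_recl big_ord0 addr0 coefC.
Qed.

Lemma lvertex_lambda_eval p : lvertex K w * lambda_eval w l p = lambda_eval w l p :> L.
Proof.
rewrite /lambda_eval mulr_sumr; apply: eq_bigr => i _.
by rewrite -leavitt_scalerAr lambda_powE mulrA lvertexM eqxx.
Qed.

End Lambda.

Definition cyc (w : vertex E) : seq (edge E) :=
  xget [::] [set l | closed_simple_path w l]%classic.

Lemma cycP w : K1 w -> closed_simple_path w (cyc w).
Proof.
case=> l [lP _]; rewrite /cyc; case: xgetP => [y -> //|/(_ l)].
by rewrite /= lP.
Qed.

Lemma cyc_unique w l : K1 w -> closed_simple_path w l -> l = cyc w.
Proof. by move=> kw lP; case: (kw) => l' [_ u]; rewrite -(u _ lP) -(u _ (cycP kw)). Qed.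

(* At a vertex that is not K1 only the values at constant polynomials are meaningful. *)
Definition ev (w : vertex E) (p : {poly K}) : L :=
  if `[< K1 w >] then lambda_eval w (cyc w) p else p`_0 *: lvertex K w.

Lemma ev_K1 w p : K1 w -> ev w p = lambda_eval w (cyc w) p.
Proof. by move=> kw; rewrite /ev asboolT. Qed.

Lemma evC w c : ev w c%:P = c *: lvertex K w.
Proof.
rewrite /ev; case: asboolP => [kw|_]; last by rewrite coefC.
by rewrite lambda_evalC // cycP.
Qed.
Lemma ev0 w : ev w 0 = 0.
Proof. by rewrite -[0 in LHS]/(0%:P) evC scale0r. Qed.
Lemma ev1 w : ev w 1 = lvertex K w.
Proof. by rewrite -[1 in LHS]/(1%:P) evC scale1r. Qed.
Lemma evD w p q : ev w (p + q) = ev w p + ev w q.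
Proof.
rewrite /ev; case: asboolP => [kw|_]; last by rewrite coefD scalerDl.
exact: lambda_evalD.
Qed.
Lemma evZ w a p : ev w (a *: p) = a *: ev w p.
Proof.
rewrite /ev; case: asboolP => [kw|_]; last by rewrite coefZ scalerA.
exact: lambda_evalZ.
Qed.
Lemma evMX w p : K1 w -> ev w (p * 'X) = ev w p * path_elt K (cyc w).
Proof. by move=> kw; rewrite !ev_K1 // lambda_evalMX // cycP. Qed.
Lemma evXM w p : K1 w -> ev w (p * 'X) = path_elt K (cyc w) * ev w p.
Proof. by move=> kw; rewrite !ev_K1 // lambda_evalXM // cycP. Qed.
Lemma lvertex_ev w p : lvertex K w * ev w p = ev w p.
Proof.
rewrite /ev; case: asboolP => [kw|_]; first by rewrite lvertex_lambda_eval // cycP.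
by rewrite -leavitt_scalerAr lvertexM eqxx.
Qed.

(** * Traces of an ideal at a vertex *)

Section IdealTheory.
Variable I : set L.
Hypothesis iI : is_ideal I.

Lemma is_ideal0 : I 0. Proof. by case: iI. Qed.
Lemma is_idealD x y : I x -> I y -> I (x + y). Proof. by case: iI => _ h _ _; exact: h. Qed.
Lemma is_idealZ a x : I x -> I (a *: x). Proof. by case: iI => _ _ h _; exact: h. Qed.
Lemma is_idealMl x y : I y -> I (x * y). Proof. by case: iI => _ _ _ h /(h x)[]. Qed.
Lemma is_idealMr x y : I x -> I (x * y). Proof. by case: iI => _ _ _ h /(h y)[]. Qed.
Lemma ideal_sum (J : finType) (P : pred J) (F : J -> L) :
  (forall j, P j -> I (F j)) -> I (\sum_(j | P j) F j).
Proof.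
move=> IF; elim/big_rec: _ => [|j x Pj Ix]; first exact: is_ideal0.
by apply: is_idealD => //; exact: IF.
Qed.

Lemma ideal_ev w p : I (lvertex K w) -> I (ev w p).
Proof. by move=> Iw; rewrite -lvertex_ev; exact: is_idealMr. Qed.

Lemma ideal_hereditary v p w : walk v p w -> I (lvertex K v) -> I (lvertex K w).
Proof.
move=> vw Iv; have [y <-] := path_elt_cancel vw; apply: is_idealMl.
case: p vw => [/eqP<-|e p vw]; first by apply: is_idealMl.
by rewrite -(path_elt_src vw); do 2!apply: is_idealMr.
Qed.

Lemma ideal_saturated v : (exists e : edge E, src e = v) ->
  (forall e : edge E, src e = v -> I (lvertex K (rng e))) -> I (lvertex K v).
Proof.
move=> ve Ir; rewrite (lvertex_CK2 ve); apply: ideal_sum => e /eqP ev.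
by rewrite -ledge_rng; apply: is_idealMr; apply: is_idealMl; apply: Ir.
Qed.

(** Outside [K1] vertices [ev] forgets all but the constant term, so membership can reflect
    divisibility only for constants. *)
Definition ev_domain (w : vertex E) (p : {poly K}) : Prop := K1 w \/ (size p <= 1)%N.
Definition admissible (w : vertex E) (g : {poly K}) : Prop :=
  normal_gen g /\ (K1 w \/ g = 0 \/ g = 1).

Lemma admissible_domain w g : admissible w g -> ev_domain w g.
Proof.
case=> _ [kw|[->|->]]; [by left|right; by rewrite size_poly0|right; by rewrite size_poly1].
Qed.

Lemma signature_exists w :
  exists2 g, admissible w g & forall p, ev_domain w p -> (I (ev w p) <-> g %| p).
Proof.
case: (pselect (K1 w)) => [kw|nkw].
  case: (@normal_gen_exists K (fun p => I (ev w p))).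
  - by rewrite ev0; exact: is_ideal0.
  - by move=> p q Ip Iq; rewrite evD; exact: is_idealD.
  - by move=> a p Ip; rewrite evZ; exact: is_idealZ.
  - by move=> p Ip; rewrite evMX //; exact: is_idealMr.
  - move=> p; rewrite evXM // => Ip.
    have := cycP kw; have [y yp] : exists y, y * path_elt K (cyc w) = lvertex K w.
      have cw := cycP kw; case/and3P: (cw) => _ /path_elt_cancel[y yp] _.
      by exists y; rewrite -{1}(closed_simple_path_rng cw).
    by move=> _; rewrite -lvertex_ev -yp -mulrA; exact: is_idealMl.
  - by move=> g gn gP; exists g => [|p _]; [split; [|left] | exact: gP].
have evc p : ev w p = p`_0 *: lvertex K w by rewrite /ev asboolF.
case: (pselect (I (lvertex K w))) => Iw.
  exists 1 => [|p _]; first by split; [exact: normal_gen1 | right; right].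
  by split=> [_|_]; [rewrite dvd1p | exact: ideal_ev].
exists 0 => [|p [//|sp]]; first by split; [exact: normal_gen0 | right; left].
rewrite dvd0p (size1_polyC sp) evC polyC_eq0; split=> [Ip|/eqP->]; last first.
  by rewrite scale0r; exact: is_ideal0.
apply: contrapT => /negP c0; apply: Iw.
by rewrite -[lvertex K w]scale1r -(mulVf c0) -scalerA; exact: is_idealZ.
Qed.

End IdealTheory.

Lemma ideal_gen_ideal (G : set L) : is_ideal (ideal_gen G).
Proof.
split=> [J [[] //]|x y Ix Iy J JG|a x Ix J JG|x y Iy].
- by apply: is_idealD; [case: JG | exact: Ix | exact: Iy].
- by apply: is_idealZ; [case: JG | exact: Ix].
by split=> J JG; [apply: is_idealMl | apply: is_idealMr]; first [by case: JG | exact: Iy].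
Qed.

End Evaluation.

Local Open Scope classical_set_scope.

(** * Signatures of ideals *)

Section Walks.
Variable E : fin_digraph.

Definition reaches (v w : vertex E) : Prop := exists p, walk v p w.

Lemma reaches_refl v : reaches v v. Proof. by exists [::]; rewrite /= eqxx. Qed.

Lemma walk_split v p (e : edge E) q w :
  walk v (p ++ e :: q) w = walk v p (src e) && walk (rng e) q w.
Proof.
elim: p v => [|a p IH] v /=; first by rewrite eq_sym.
by rewrite IH andbA.
Qed.

(** The walk is stopped at its first visit to [w]. *)
Lemma walk_shorten v p w : walk v p w ->
  exists2 q, walk v q w & all (fun e : edge E => src e != w) q.
Proof.
elim: p v => [|e p IH] v /=; first by exists [::].
have [-> _|vw] := eqVneq v w; first by exists [::]; rewrite //= eqxx.
case/andP=> /eqP ev /IH[q wq aq]; exists (e :: q); rewrite /= ev ?eqxx //.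
by rewrite vw.
Qed.

(** Following [l] up to the source of [e], then [e'] and a shortest return to [w], gives a second
    closed simple path. By uniqueness it is [l], and the edges after the common prefix must
    agree. *)
Lemma K1_no_return_exit (w : vertex E) l e e' : K1 w -> closed_simple_path w l ->
  e \in l -> src e' = src e -> reaches (rng e') w -> e' = e.
Proof.
(* The return walk is cut at its first arrival so that the base vertex is not met in between. *)
move=> kw lP el; case/splitPr: el lP => l1 l2 lP s [p /walk_shorten[q wq aq]].
suff qP : closed_simple_path w (l1 ++ e' :: q).
  case: kw => c [_ u]; have := u _ qP; rewrite (u _ lP).
  by move=> /(congr1 (drop (size l1))); rewrite !drop_size_cat // => -[].
case/and3P: lP => _; rewrite walk_split => /andP[w1 _].
case: l1 w1 => [|a l1] w1 al; rewrite /closed_simple_path walk_split s w1 wq //=.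
by move: al; rewrite /= !all_cat /= s => /and3P[-> -> _].
Qed.

(** By the return hypothesis a live edge leaving a vertex of the cycle can come back to [w], so it
    is the edge of the cycle itself. *)
Lemma K1_exitless (X : {set vertex E}) w l : hereditary X -> w \notin X ->
  K1 w -> closed_simple_path w l ->
  (forall e : edge E, reaches w (src e) -> rng e \notin X -> reaches (rng e) w) ->
  exitless X l.
Proof.
move=> hX wX kw lP ret e el.
have [w1 w2] : reaches w (src e) /\ reaches (rng e) w.
  case/and3P: (lP) => _ + _; case/splitPr: el => l1 l2.
  by rewrite walk_split => /andP[h1 h2]; split; [exists l1|exists l2].
split=> [|e' s le']; first by apply: contraNN wX => /hX; apply.
by apply: (K1_no_return_exit kw lP el s); apply: ret => //; rewrite s.
Qed.

End Walks.

(** * Reducible ideals and their generators at the vertices *)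

Section Signatures.
Variables (K : fieldType) (E : fin_digraph).
Local Notation L := (leavitt K E).

Definition gens (g : vertex E -> {poly K}) : set L :=
  [set x | exists w, x = ev w (g w)].

Lemma ideal_genP (G I : set L) : is_ideal I -> (ideal_gen G `<=` I <-> G `<=` I).
Proof.
move=> iI; split=> GI; last exact: smallest_sub.
by move=> x Gx; apply: GI; exact: sub_gen_smallest.
Qed.

Lemma normal_gen_size (g : {poly K}) : g \is monic -> g != 1 -> (1 < size g)%N.
Proof.
move=> gm; rewrite ltnNge; apply: contraNN => /size1_polyC gC.
by move: gm; rewrite gC monicE lead_coefC => /eqP->.
Qed.

Lemma lambda_coefs_monic (g : {poly K}) :
  g \is monic -> g`_0 != 0 -> g != 1 -> lambda_coefs g.
Proof.
move=> gm g0 /(normal_gen_size gm) sg; split=> //.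
have : last 0 g != 0 by rewrite -nth_last -/(lead_coef g) (monicP gm) oner_eq0.
case: (polyseq g) sg g0 => [|a [|b s]] //= _ -> lbs.
rewrite ltnS -/(count _ (b :: s)) -has_count.
by apply/hasP; exists (last b s) => //; exact: mem_last.
Qed.

Lemma gens_reducible (g : vertex E -> {poly K}) :
  (forall w, admissible w (g w)) -> hereditary [set w | g w == 1] ->
  saturated [set w | g w == 1] -> lambda_reducible (ideal_gen (gens g)).
Proof.
move=> ga hX sX.
(* Generators equal to 0 contribute nothing, those equal to 1 are the vertices of the hereditary
   saturated set, and the remaining ones occur only at [K1] vertices. *)
exists {w | K1 w /\ (g w != 0) && (g w != 1)}, sval, (fun a => cyc (sval a)),
  (fun a => g (sval a)), [set w | g w == 1]%SET; split=> //.
  case=> w /= [kw /andP[g0 g1]]; split; first by split=> //; exact: cycP.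
  case: (ga w) => /orP[gz|/andP[gm gc]] _; first by rewrite gz in g0.
  exact: lambda_coefs_monic.
set G := _ `|` _; have GI : G `<=` ideal_gen G by exact: sub_gen_smallest.
apply/seteqP; split; (apply/ideal_genP; first exact: ideal_gen_ideal) => x.
  case=> w ->; have [->|g0] := eqVneq (g w) 0.
    by rewrite ev0; apply: is_ideal0; exact: ideal_gen_ideal.
  have [g1|g1] := eqVneq (g w) 1.
    by apply: GI; right; exists w; rewrite ?inE g1 ?ev1.
  have kw : K1 w by case: (ga w) => _ [//|[]] /eqP; rewrite ?(negbTE g0) ?(negbTE g1).
  apply: GI; left.
  have a : K1 w /\ (g w != 0) && (g w != 1) by rewrite g0 g1.
  by exists (exist _ w a); rewrite ev_K1.
case=> [[[w [kw wg]] ->]|[w]] /=.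
  by rewrite -ev_K1 //; apply: sub_gen_smallest; exists w.
rewrite inE => /eqP gw ->; rewrite -ev1 -gw.
by apply: sub_gen_smallest; exists w.
Qed.

Definition signature_spec (I : set L) (w : vertex E) (g : {poly K}) : Prop :=
  admissible w g /\ forall p, ev_domain w p -> (I (ev w p) <-> g %| p).

Definition signature (I : set L) (w : vertex E) : {poly K} := xget 0 (signature_spec I w).

Lemma signatureP (I : set L) w : is_ideal I -> signature_spec I w (signature I w).
Proof.
move=> iI; have [g ga gP] := signature_exists iI w.
by rewrite /signature; case: xgetP => [y _ //|/(_ g)[]].
Qed.

Lemma signature_admissible (I : set L) w : is_ideal I -> admissible w (signature I w).
Proof. by move=> /signatureP-/(_ w)[]. Qed.

Lemma signature_mem (I : set L) w : is_ideal I -> I (ev w (signature I w)).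
Proof. by move=> /signatureP-/(_ w)[ag gP]; apply/gP => //; exact: admissible_domain ag. Qed.

Lemma signature_vertex (I : set L) w : is_ideal I ->
  (I (lvertex K w) <-> signature I w = 1).
Proof.
move=> iI; have [[gn ga] gP] := signatureP w iI; rewrite -ev1; split=> [/gP|g1].
  move=> h; apply: normal_gen_antisym => //; rewrite ?normal_gen1 ?dvd1p //.
  by apply: h; right; rewrite size_poly1.
by apply/gP; [right; rewrite size_poly1 | rewrite g1].
Qed.

Lemma reducible_ideal (I : set L) : lambda_reducible I -> is_ideal I.
Proof. by case=> A [v [lam [p [X [_ _ _ ->]]]]]; exact: ideal_gen_ideal. Qed.

(** Each given generator lies in [I], hence is a multiple of the signature at its base vertex and
    already belongs to the ideal generated by the signatures. A [lambda_reducible] ideal is thus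
    determined by its signature. *)
Lemma reducible_gens (I : set L) : lambda_reducible I -> I = ideal_gen (gens (signature I)).
Proof.
move=> rI; have iI := reducible_ideal rI; apply/seteqP; split; last first.
  by apply/ideal_genP => // x [w ->]; exact: signature_mem.
case: rI => A [v [lam [p [X [lamP hX sX defI]]]]].
rewrite {1}defI; apply/ideal_genP; first exact: ideal_gen_ideal.
have GI : gens (signature I) `<=` ideal_gen (gens (signature I)) by exact: sub_gen_smallest.
have sI x : ([set x | exists a, x = lambda_eval (v a) (lam a) (p a)]
    `|` [set x | exists2 w, w \in X & x = lvertex K w]) x -> I x.
  by rewrite defI; exact: sub_gen_smallest.
have iG := ideal_gen_ideal (gens (signature I)).
move=> x xG; have Ix := sI _ xG; case: xG => [[a xa]|[w wX xw]].
  case: (lamP a) => -[ka /(cyc_unique ka) la] _.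
  move: Ix; rewrite xa la -ev_K1 // => Ix.
  have [_ gP] := signatureP (v a) iI; have [_ hP] := signatureP (v a) iG.
  apply/hP; first by left.
  apply: (dvdp_trans _ (_ : signature I (v a) %| p a)); last by apply/gP => //; left.
  apply/hP; first by apply: admissible_domain; exact: signature_admissible.
  by apply: GI; exists (v a).
rewrite xw in Ix *; have s1 : signature I w = 1 by apply/(signature_vertex _ iI).
by rewrite -ev1 -s1; apply: GI; exists w.
Qed.

Lemma signature_le (I J : set L) : lambda_reducible I -> lambda_reducible J ->
  (I `<=` J <-> forall w, signature J w %| signature I w).
Proof.
move=> rI rJ; have iI := reducible_ideal rI; have iJ := reducible_ideal rJ.
rewrite [in X in X <-> _](reducible_gens rI) ideal_genP //.
split=> [IJ w|IJ x [w ->]]; have [_ gP] := signatureP w iJ.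
  by apply/gP; [apply: admissible_domain; exact: signature_admissible | apply: IJ; exists w].
by apply/gP => //; apply: admissible_domain; exact: signature_admissible.
Qed.

Lemma signature_gens (g : vertex E -> {poly K}) : (forall w, admissible w (g w)) ->
  (forall w p, ev_domain w p -> ideal_gen (gens g) (ev w p) -> g w %| p) ->
  signature (ideal_gen (gens g)) = g.
Proof.
move=> ga gP; apply/funext => w; have iG := ideal_gen_ideal (gens g).
have [ha hP] := signatureP w iG.
apply: normal_gen_antisym; [by case: ha|by case: (ga w)| |].
  apply/hP; first exact: admissible_domain.
  by apply: sub_gen_smallest; exists w.
by apply: gP; [exact: admissible_domain ha | exact: signature_mem].
Qed.

(** The independence statement. In the representation with dead set [X] every generator away from
    [w] is zero, so once the kernel contains the generator at [w] it contains the whole ideal, and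
    in particular [ev w p]. *)
Lemma dvd_of_mem_gens (g : vertex E -> {poly K}) (X : {set vertex E}) w p :
  (forall v, admissible v (g v)) -> hereditary X -> saturated X -> w \notin X ->
  (forall v, v != w -> v \in X \/ g v = 0) ->
  (forall e : edge E, reaches w (src e) -> rng e \notin X -> reaches (rng e) w) ->
  ev_domain w p -> ideal_gen (gens g) (ev w p) -> g w %| p.
Proof.
move=> ga hX sX wX gX ret pd gp.
have kill N : is_ideal N -> (forall v, v \in X -> N (lvertex K v)) ->
    N (ev w (g w)) -> N (ev w p).
  move=> iN NX Nw; apply: (_ : ideal_gen (gens g) `<=` N) => //.
  apply/ideal_genP => // x [v ->]; have [->//|/gX[/NX|->]] := eqVneq v w.
    exact: ideal_ev.
  by rewrite ev0; exact: is_ideal0.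
case: (pselect (K1 w)) => [kw|nkw].
  have xl := K1_exitless hX wX kw (cycP kw) ret.
  (* The twist may be the companion matrix of any suitable divisor [h] of [g w]. This freedom is
     used when [g w] is 0, where every [h] qualifies. *)
  have step h : h \is monic -> (1 < size h)%N -> h`_0 != 0 -> h %| g w -> h %| p.
    move=> hm h1 h0 hg; have [n [M [uM MP]]] := companion_unitmx hm h1 h0.
    have kerP := rep_ker_lambda hX sX uM (cycP kw) xl.
    apply/MP/kerP; rewrite -ev_K1 //; apply: (kill (rep_ker X M w)).
    - exact: rep_ker_ideal.
    - by move=> v; case: (rep_ker_vertex hX sX w uM v).
    by rewrite ev_K1 //; apply/kerP/MP.
  case: (ga w) => gn _; have [->|g1] := eqVneq (g w) 1; first exact: dvd1p.
  case/orP: gn => [/eqP g0|/andP[gm gc]]; last by apply: step => //; exact: normal_gen_size.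
  (* [p] is divisible by a power of [X - 1] of larger degree, hence zero. *)
  rewrite g0 dvd0p; pose h : {poly K} := ('X - 1%:P) ^+ (size p).+1.
  have hm : h \is monic by rewrite monic_exp ?monicXsubC.
  have sh : size h = (size p).+2 by rewrite size_exp_XsubC.
  apply: contraT => p0; suff /(dvdp_leq p0) : h %| p by rewrite sh ltnNge ltnW.
  apply: step; rewrite ?sh ?g0 ?dvdp0 //.
  rewrite -horner_coef0 horner_exp hornerXsubC sub0r.
  by rewrite expf_neq0 // oppr_eq0 oner_eq0.
case: (ga w) => gn [//|[g0|->]]; last exact: dvd1p.
case: pd => // /size1_polyC pC; rewrite g0 pC dvd0p polyC_eq0.
(* At a vertex that is not [K1] it only matters whether the vertex survives, so the untwisted
   representation on scalars is enough. *)
have u1 : (1%:M : 'M[K]_1) \in unitmx by rewrite unitmx1.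
apply: contraT => c0; case/negP: wX; apply/(rep_ker_vertex hX sX w u1 w).
have iN := rep_ker_ideal hX sX w u1.
have -> : lvertex K w = (p`_0)^-1 *: ev w p.
  by rewrite [X in ev w X]pC evC scalerA mulVf // scale1r.
apply: (is_idealZ iN); apply: (kill _ iN).
  by move=> v; case: (rep_ker_vertex hX sX w u1 v).
by rewrite g0 ev0; exact: (is_ideal0 iN).
Qed.

End Signatures.

(** * Posets of pairs of polynomials *)

Section OrderIso.
Variables (T U : Type) (leT : T -> T -> Prop) (leU : U -> U -> Prop).

Lemma bijective_inj_surj (f : T -> U) :
  injective f -> (forall y, exists x, f x = y) -> bijective f.
Proof.
move=> fi fs; pose g y := sval (cid (fs y)).
have gK y : f (g y) = y by rewrite /g; case: cid.
by exists g => // x; apply: fi; rewrite gK.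
Qed.

Lemma order_iso_embedding (f : T -> U) :
  (forall x y, leT x y -> leT y x -> x = y) -> (forall x, leU x x) ->
  (forall x y, leT x y <-> leU (f x) (f y)) -> (forall y, exists x, f x = y) ->
  order_iso leT leU.
Proof.
move=> anti refl emb surj; exists f; split=> //; apply: bijective_inj_surj => //.
by move=> x y fxy; apply: anti; apply/emb; rewrite fxy.
Qed.

Lemma order_iso_sym : order_iso leT leU -> order_iso leU leT.
Proof.
move=> [f [[g fK gK] emb]]; exists g; split; first by exists f.
by move=> x y; rewrite -{1}(gK x) -{1}(gK y); split=> /emb.
Qed.

Lemma is_lattice_iso : order_iso leT leU -> is_lattice leU -> is_lattice leT.
Proof.
move=> [f [[g fK gK] emb]] [refl anti tr meet join]; split.
- by move=> x; apply/emb.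
- by move=> x y /emb h /emb h'; rewrite -(fK x) (anti _ _ h h').
- by move=> x y z /emb h /emb h'; apply/emb; exact: tr h h'.
- move=> x y; have [m [mx my mP]] := meet (f x) (f y); exists (g m).
  by split=> [||z /emb h /emb h']; apply/emb; rewrite gK //; exact: mP.
- move=> x y; have [m [mx my mP]] := join (f x) (f y); exists (g m).
  by split=> [||z /emb h /emb h']; apply/emb; rewrite gK //; exact: mP.
Qed.
End OrderIso.

Lemma order_iso_trans (T U V : Type) leT leU leV :
  @order_iso T U leT leU -> @order_iso U V leU leV -> order_iso leT leV.
Proof.
move=> [f [bf ef]] [g [bg eg]]; exists (g \o f); split; first exact: bij_comp.
by move=> x y; split=> [/ef/eg//|/eg/ef].
Qed.

Section PairPosets.
Variable K : fieldType.
Local Notation pair := ({poly K} * {poly K})%type.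

(** The flag [k] records whether the vertex is [K1]. *)
Definition chain (k : bool) (g : {poly K}) : bool :=
  normal_gen g && [|| k, g == 0 | g == 1].

Definition pair_le (x y : pair) : bool := (y.1 %| x.1) && (y.2 %| x.2).

(* The first coordinate is a placeholder, so that all forms consist of pairs. *)
Definition single_pred (k : bool) (x : pair) : bool := (x.1 == 1) && chain k x.2.
Definition prod_pred (ku kv : bool) (x : pair) : bool := chain ku x.1 && chain kv x.2.
Definition stack_pred (ku kv : bool) (x : pair) : bool :=
  prod_pred ku kv x && ((x.1 == 0) || (x.2 == 1)).

Definition form_pred (i : lattice_form) : pred pair :=
  match i with
  | FI => single_pred false | FII => single_pred true
  | FIII => stack_pred true false | FIV => stack_pred true true
  | FV => stack_pred false false | FVI => stack_pred false true
  | FVII => prod_pred false false | FVIII => prod_pred true false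
  | FIX => prod_pred true true
  end.

Definition pair_poset (P : pred pair) := {x : pair | P x}.
Definition pair_poset_le (P : pred pair) (x y : pair_poset P) : Prop :=
  pair_le (sval x) (sval y).

Lemma chain_normal k g : chain k g -> normal_gen g. Proof. by case/andP. Qed.

Lemma chain0 k : chain k 0.
Proof. by rewrite /chain normal_gen0 eqxx orbT. Qed.
Lemma chain1 k : chain k 1.
Proof. by rewrite /chain normal_gen1 eqxx !orbT. Qed.

Lemma chain_antisym k g h : chain k g -> chain k h -> g %| h -> h %| g -> g = h.
Proof. by move=> /chain_normal gn /chain_normal; exact: normal_gen_antisym. Qed.

Lemma normal_gen_prod ku kv x : prod_pred ku kv x -> normal_gen x.1 && normal_gen x.2.
Proof. by case/andP=> /chain_normal-> /chain_normal->. Qed.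

Lemma form_pred_normal i x : form_pred i x -> normal_gen x.1 && normal_gen x.2.
Proof.
have single k : single_pred k x -> normal_gen x.1 && normal_gen x.2.
  by case/andP=> /eqP-> /chain_normal->; rewrite normal_gen1.
case: i => /=; first [exact: single | exact: normal_gen_prod | by case/andP=> /normal_gen_prod].
Qed.

Lemma pair_le_refl x : pair_le x x. Proof. by rewrite /pair_le !dvdpp. Qed.

Lemma pair_le_trans x y z : pair_le x y -> pair_le y z -> pair_le x z.
Proof.
by case/andP=> xy1 xy2 /andP[yz1 yz2]; apply/andP; split;
  [exact: dvdp_trans yz1 xy1 | exact: dvdp_trans yz2 xy2].
Qed.

Lemma pair_le_antisym (x y : pair) : normal_gen x.1 && normal_gen x.2 ->
  normal_gen y.1 && normal_gen y.2 -> pair_le x y -> pair_le y x -> x = y.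
Proof.
case: x y => [a b] [c d] /andP[an bn] /andP[cn dn] /andP[ca db] /andP[ac bd].
by congr (_, _); exact: normal_gen_antisym.
Qed.

(** In the reversed order a join is a gcd. Applying [normal_gen_exists] to the multiples of
    [gcdp a b] replaces it by its normalised associate; for meets the same is done with the common
    multiples of [a] and [b]. *)
Lemma chain_join k a b : chain k a -> chain k b ->
  exists j, [/\ chain k j, j %| a, j %| b & forall z, z %| a -> z %| b -> z %| j].
Proof.
case: k; last first.
  case/andP=> _ /= /orP[]/eqP-> /andP[_ /= /orP[]/eqP->].
  - by exists 0; rewrite chain0 !(dvd1p, dvdpp, dvdp0).
  - by exists 1; rewrite chain1 !(dvd1p, dvdpp, dvdp0).
  - by exists 1; rewrite chain1 !(dvd1p, dvdpp, dvdp0).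
  - by exists 1; rewrite chain1 !(dvd1p, dvdpp, dvdp0).
move=> /chain_normal an /chain_normal bn.
case: (@normal_gen_exists K (fun p => gcdp a b %| p)).
- exact: dvdp0.
- by move=> p q; exact: dvdp_add.
- by move=> c p h; rewrite -mul_polyC dvdp_mull.
- by move=> p; exact: dvdp_mulr.
- move=> p; case/orP: (an) => [/eqP a0|/andP[am a0]].
    by rewrite a0 gcd0p; exact: normal_gen_dvdMX.
  rewrite Gauss_dvdpl //; apply: coprimep_dvdr (dvdp_gcdl a b) _.
  by rewrite -['X]subr0 -[0]/(0%:P) coprimep_XsubC /root horner_coef0.
move=> j jn jP; exists j; rewrite /chain jn; split=> // [||z za zb].
- by apply/jP; exact: dvdp_gcdl.
- by apply/jP; exact: dvdp_gcdr.
by apply: (@dvdp_trans _ (gcdp a b)); [rewrite dvdp_gcd za | apply/jP].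
Qed.

Lemma chain_meet k a b : chain k a -> chain k b ->
  exists m, [/\ chain k m, a %| m, b %| m & forall z, a %| z -> b %| z -> m %| z].
Proof.
case: k; last first.
  case/andP=> _ /= /orP[]/eqP-> /andP[_ /= /orP[]/eqP->].
  - by exists 0; rewrite chain0 !(dvd1p, dvdpp, dvdp0).
  - by exists 0; rewrite chain0 !(dvd1p, dvdpp, dvdp0).
  - by exists 0; rewrite chain0 !(dvd1p, dvdpp, dvdp0).
  - by exists 1; rewrite chain1 !(dvd1p, dvdpp, dvdp0).
move=> /chain_normal an /chain_normal bn.
case: (@normal_gen_exists K (fun p => (a %| p) && (b %| p))).
- by rewrite !dvdp0.
- by move=> p q /andP[? ?] /andP[? ?]; rewrite !dvdp_add.
- by move=> c p /andP[? ?]; rewrite -mul_polyC !dvdp_mull.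
- by move=> p /andP[? ?]; rewrite !dvdp_mulr.
- by move=> p /andP[ap bp]; apply/andP; split; exact: normal_gen_dvdMX.
move=> m mn mP; have /andP[am bm] := proj2 (mP m) (dvdpp m).
exists m; split=> [|||z az bz].
- by rewrite /chain mn.
- exact: am.
- exact: bm.
by apply: (proj1 (mP z)); rewrite az bz.
Qed.

Lemma chain_eq1 k g : chain k g -> g %| 1 -> g = 1.
Proof. by move=> gc g1; apply: chain_antisym gc (chain1 k) g1 (dvd1p _). Qed.

(** Products of chains are lattices, and the extra conditions of [single_pred] and [stack_pred] are
    preserved by the meets and joins of such a product. *)
Lemma form_pred_lattice i : is_lattice (@pair_poset_le (form_pred i)).
Proof.
have dvd0 (p : {poly K}) : 0 %| p -> p = 0 by rewrite dvd0p => /eqP.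
suff [meet join] : (forall x y : pair, form_pred i x -> form_pred i y -> exists m,
      [/\ form_pred i m, pair_le m x, pair_le m y &
          forall z, pair_le z x -> pair_le z y -> pair_le z m]) /\
    (forall x y : pair, form_pred i x -> form_pred i y -> exists j,
      [/\ form_pred i j, pair_le x j, pair_le y j &
          forall z, pair_le x z -> pair_le y z -> pair_le j z]).
  split.
  - by move=> x; exact: pair_le_refl.
  - move=> [x xP] [y yP] xy yx; apply: eq_exist.
    exact: pair_le_antisym (form_pred_normal xP) (form_pred_normal yP) xy yx.
  - by move=> x y z; exact: pair_le_trans.
  - move=> [x xP] [y yP]; have [m [mP mx my mz]] := meet _ _ xP yP.
    by exists (exist _ m mP); split=> // -[z zP]; exact: mz.
  - move=> [x xP] [y yP]; have [m [mP mx my mz]] := join _ _ xP yP.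
    by exists (exist _ m mP); split=> // -[z zP]; exact: mz.
have prodM ku kv x y : prod_pred ku kv x -> prod_pred ku kv y -> exists m : pair,
    [/\ prod_pred ku kv m, pair_le m x, pair_le m y &
        forall z, pair_le z x -> pair_le z y -> pair_le z m].
  move=> /andP[x1 x2] /andP[y1 y2]; have [m1 [c1 d1 e1 f1]] := chain_meet x1 y1.
  have [m2 [c2 d2 e2 f2]] := chain_meet x2 y2; exists (m1, m2).
  rewrite /prod_pred /pair_le /= c1 c2 d1 d2 e1 e2; split=> // z /andP[? ?] /andP[? ?].
  by rewrite f1 ?f2.
have prodJ ku kv x y : prod_pred ku kv x -> prod_pred ku kv y -> exists m : pair,
    [/\ prod_pred ku kv m, pair_le x m, pair_le y m &
        forall z, pair_le x z -> pair_le y z -> pair_le m z].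
  move=> /andP[x1 x2] /andP[y1 y2]; have [m1 [c1 d1 e1 f1]] := chain_join x1 y1.
  have [m2 [c2 d2 e2 f2]] := chain_join x2 y2; exists (m1, m2).
  rewrite /prod_pred /pair_le /= c1 c2 d1 d2 e1 e2; split=> // z /andP[? ?] /andP[? ?].
  by rewrite f1 ?f2.
have single k : single_pred k =1 (fun x => prod_pred false k x && (x.1 == 1)).
  move=> x; rewrite /single_pred /prod_pred; case: eqP => [->|]; last by rewrite andbF.
  by rewrite chain1 andbT.
have closed (P : pred pair) ku kv (c : pred pair) :
    P =1 (fun x => prod_pred ku kv x && c x) ->
    (forall x y m, prod_pred ku kv m -> c x -> c y -> pair_le m x -> pair_le m y ->
       (forall z, pair_le z x -> pair_le z y -> pair_le z m) -> c m) ->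
    (forall x y m, prod_pred ku kv m -> c x -> c y -> pair_le x m -> pair_le y m ->
       (forall z, pair_le x z -> pair_le y z -> pair_le m z) -> c m) ->
  (forall x y : pair, P x -> P y -> exists m,
      [/\ P m, pair_le m x, pair_le m y &
          forall z, pair_le z x -> pair_le z y -> pair_le z m]) /\
    (forall x y : pair, P x -> P y -> exists j,
      [/\ P j, pair_le x j, pair_le y j &
          forall z, pair_le x z -> pair_le y z -> pair_le j z]).
  move=> PE cM cJ; split=> x y; rewrite !PE => /andP[xp xc] /andP[yp yc].
    have [m [mp mx my mz]] := prodM _ _ _ _ xp yp.
    by exists m; rewrite PE mp (cM x y).
  have [m [mp mx my mz]] := prodJ _ _ _ _ xp yp.
  by exists m; rewrite PE mp (cJ x y).
have singleL k := closed _ _ _ _ (single k).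
have stackL ku kv := closed (stack_pred ku kv) _ _ _ (fun x => erefl).
(* One test pair settles each closure: [(1, 0)] lies below every pair with first coordinate 1, and
   [(0, 1)] lies below every pair with second coordinate 1 and above every pair with first
   coordinate 0. *)
have cS k x y m : prod_pred false k m -> x.1 == 1 -> y.1 == 1 ->
    pair_le m x -> pair_le m y ->
    (forall z, pair_le z x -> pair_le z y -> pair_le z m) -> m.1 == 1.
  case/andP=> mc _ /eqP x1 /eqP y1 _ _ /(_ (1, 0)); rewrite /pair_le /= x1 y1.
  by rewrite !dvdp0 dvdpp => /(_ isT isT)/andP[/(chain_eq1 mc)->].
have cSJ k x y m : prod_pred false k m -> x.1 == 1 -> y.1 == 1 ->
    pair_le x m -> pair_le y m ->
    (forall z, pair_le x z -> pair_le y z -> pair_le m z) -> m.1 == 1.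
  by case/andP=> mc _ /eqP x1 _ /andP[+ _]; rewrite x1 => /(chain_eq1 mc)->.
pose c (x : pair) := (x.1 == 0) || (x.2 == 1).
have cT ku kv x y m : prod_pred ku kv m -> c x -> c y -> pair_le m x -> pair_le m y ->
    (forall z, pair_le z x -> pair_le z y -> pair_le z m) -> c m.
  case/andP=> _ mc; rewrite /c /pair_le => /orP[/eqP x0 _|/eqP x1].
    by case/andP; rewrite x0 => /dvd0->; rewrite eqxx.
  case/orP=> [/eqP y0 _|/eqP y1 _ _ /(_ (0, 1))].
    by case/andP; rewrite y0 => /dvd0->; rewrite eqxx.
  rewrite x1 y1 !dvdp0 dvdpp => /(_ isT isT)/andP[_ /(chain_eq1 mc)->].
  by rewrite eqxx orbT.
have cTJ ku kv x y m : prod_pred ku kv m -> c x -> c y -> pair_le x m -> pair_le y m ->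
    (forall z, pair_le x z -> pair_le y z -> pair_le m z) -> c m.
  case/andP=> _ mc; rewrite /c /pair_le => /orP[/eqP x0|/eqP x1]; last first.
    by move=> _ /andP[_]; rewrite x1 => /(chain_eq1 mc)->; rewrite eqxx orbT.
  case/orP=> [/eqP y0|/eqP y1]; last first.
    by move=> _ /andP[_]; rewrite y1 => /(chain_eq1 mc)->; rewrite eqxx orbT.
  move=> _ _ /(_ (0, 1)); rewrite /= x0 y0 dvdpp !dvd1p => /(_ isT isT)/andP[/dvd0-> _].
  by rewrite eqxx.
case: i => /=; do ?[by split=> x y; [exact: prodM | exact: prodJ]].
1,2: by apply: singleL; [exact: cS | exact: cSJ].
all: by apply: stackL; [exact: cT | exact: cTJ].
Qed.

End PairPosets.

(** * Graphs with two vertices *)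

Section TwoCycle.
Variables (E : fin_digraph) (u v : vertex E) (a b : edge E).
Hypotheses (uv : u != v) (uvT : forall w, w = u \/ w = v).
Hypotheses (au : src a = u) (av : rng a = v) (bv : src b = v) (bu : rng b = u).

Lemma two_cycle_reaches (w w' : vertex E) : reaches w w'.
Proof.
case: (uvT w) (uvT w') => -> [] ->; try exact: reaches_refl.
  by exists [:: a]; rewrite /= au av !eqxx.
by exists [:: b]; rewrite /= bv bu !eqxx.
Qed.

Lemma two_cycle_closed : closed_simple_path u [:: a; b].
Proof. by rewrite /closed_simple_path /= au av bv bu !eqxx eq_sym uv. Qed.

Lemma two_cycle_cyc : K1 u -> cyc u = [:: a; b].
Proof. by move=> k; rewrite -(cyc_unique k two_cycle_closed). Qed.

End TwoCycle.

(** All vertices reach each other, so [K1_no_return_exit] leaves exactly one edge at each vertex and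
    a closed simple path at [v] is forced edge by edge. *)
Lemma two_cycle_K1 (E : fin_digraph) (u v : vertex E) (a b : edge E) :
  u != v -> (forall w, w = u \/ w = v) ->
  src a = u -> rng a = v -> src b = v -> rng b = u -> K1 u -> K1 v.
Proof.
move=> uv uvT au av bv bu k; have vu : v != u by rewrite eq_sym.
exists [:: b; a]; split; first exact: (two_cycle_closed vu bv bu au av).
have out e : src e = u -> e = a.
  move=> eu; apply: (K1_no_return_exit k (two_cycle_closed uv au av bv bu)).
  - by rewrite inE eqxx.
  - by rewrite au.
  exact: two_cycle_reaches uvT au av bv bu _ _.
have outb e : src e = v -> e = b.
  move=> ev; apply: (K1_no_return_exit k (two_cycle_closed uv au av bv bu)).
  - by rewrite !inE eqxx orbT.
  - by rewrite bv.
  exact: two_cycle_reaches uvT au av bv bu _ _.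
case=> [|e [|e' q]] //; rewrite /closed_simple_path /=.
  by case/andP=> /andP[/eqP/outb-> ]; rewrite bu (negbTE uv).
case/andP=> /and3P[/eqP/outb-> /eqP]; rewrite bu => /out-> {e e'}.
case: q => [//|e q] /= /andP[/eqP->]; rewrite av eqxx => _.
by rewrite andbF.
Qed.

Section TwoVertices.
Variables (K : fieldType) (E : fin_digraph) (u v : vertex E).
Hypotheses (uv : u != v) (uvT : forall w, w = u \/ w = v).
Local Notation L := (leavitt K E).
Local Notation pair := ({poly K} * {poly K})%type.

Lemma hereditary_edge (X : {set vertex E}) :
  (forall e : edge E, src e \in X -> rng e \in X) -> hereditary X.
Proof.
move=> hX x y + [p]; elim: p x => [|e p IH] x /= xX; first by move/eqP <-.
by case/andP=> /eqP ex; apply: IH; apply: hX; rewrite ex.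
Qed.

Lemma hereditary_set0 : hereditary (set0 : {set vertex E}).
Proof. by move=> x y; rewrite inE. Qed.
Lemma saturated_set0 : saturated (set0 : {set vertex E}).
Proof. by move=> x [e ex] /(_ e ex); rewrite inE. Qed.

Definition pair_fun (x : pair) (w : vertex E) : {poly K} :=
  if w == u then x.1 else x.2.
Lemma pair_fun_u x : pair_fun x u = x.1. Proof. by rewrite /pair_fun eqxx. Qed.
Lemma pair_fun_v x : pair_fun x v = x.2.
Proof. by rewrite /pair_fun eq_sym (negbTE uv). Qed.

Local Notation ku := `[< K1 u >].
Local Notation kv := `[< K1 v >].

Lemma chain_admissible (w : vertex E) (g : {poly K}) : chain `[< K1 w >] g = `[< admissible w g >].
Proof.
apply/andP/asboolP => -[gn]; first case/or3P.
- by move/asboolP; split=> //; left.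
- by move/eqP; split=> //; right; left.
- by move/eqP; split=> //; right; right.
by case=> [kw|[g0|g1]]; split=> //; apply/or3P;
  [apply: Or31; exact/asboolP | apply: Or32; exact/eqP | apply: Or33; exact/eqP].
Qed.

Lemma chain_signature (I : set L) w : is_ideal I -> chain `[< K1 w >] (signature I w).
Proof. by move=> iI; rewrite chain_admissible; apply/asboolP; exact: signature_admissible. Qed.

Lemma pair_fun_admissible (x : pair) : prod_pred ku kv x -> forall w, admissible w (pair_fun x w).
Proof.
case/andP; rewrite !chain_admissible => /asboolP x1 /asboolP x2 w.
by case: (uvT w) => ->; rewrite ?pair_fun_u ?pair_fun_v.
Qed.

Lemma iso_pair_poset (P : pred pair) (h : set L -> pair) :
  (forall x, P x -> normal_gen x.1 && normal_gen x.2) ->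
  (forall I, lambda_reducible I -> P (h I)) ->
  (forall I J, lambda_reducible I -> lambda_reducible J ->
     (I `<=` J <-> pair_le (h I) (h J))) ->
  (forall x, P x -> exists2 I, lambda_reducible I & h I = x) ->
  order_iso (@lambda_le K E) (@pair_poset_le K P).
Proof.
move=> Pn Ph emb surj.
apply: (@order_iso_embedding _ _ _ _ (fun I => exist P (h (sval I)) (Ph _ (svalP I)))).
- move=> [I rI] [J rJ] IJ JI; apply: eq_exist.
  by apply/seteqP; split; [exact: IJ | exact: JI].
- by move=> x; exact: pair_le_refl.
- by move=> [I rI] [J rJ]; exact: emb.
move=> [x Px]; have [I rI hI] := surj _ Px.
by exists (exist _ I rI); exact: eq_exist.
Qed.

Lemma signature_pair_le (I J : set L) : lambda_reducible I -> lambda_reducible J ->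
  (I `<=` J <-> pair_le (signature I u, signature I v) (signature J u, signature J v)).
Proof.
move=> rI rJ; rewrite signature_le //; split=> [h|/andP[/= hu hv] w].
  by rewrite /pair_le /= !h.
by case: (uvT w) => ->.
Qed.

(** The map [h] turns an element of a form into a pair of signatures. It is needed for
    [single_pred], whose placeholder coordinate has to be replaced by the true signature at [u]. *)
Lemma pair_fun_surj (P : pred pair) (h : pair -> pair) :
  (forall x, P x -> prod_pred ku kv (h x)) ->
  (forall x, P x -> hereditary [set w | pair_fun (h x) w == 1]) ->
  (forall x, P x -> saturated [set w | pair_fun (h x) w == 1]) ->
  (forall x p, P x -> ev_domain u p ->
    ideal_gen (gens (pair_fun (h x))) (ev u p) -> (h x).1 %| p) ->
  (forall x p, P x -> ev_domain v p ->
    ideal_gen (gens (pair_fun (h x))) (ev v p) -> (h x).2 %| p) ->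
  forall x, P x -> exists2 I : set L, lambda_reducible I & (signature I u, signature I v) = h x.
Proof.
move=> hp hH hS hu hv x Px; have xa := pair_fun_admissible (hp _ Px).
exists (ideal_gen (gens (pair_fun (h x)))); first by apply: gens_reducible; auto.
rewrite signature_gens // ?pair_fun_u ?pair_fun_v; first by case: (h x).
by move=> w p; case: (uvT w) => ->; rewrite ?pair_fun_u ?pair_fun_v; [exact: hu | exact: hv].
Qed.

Lemma rng_eq_v (e : edge E) : rng e != u -> rng e = v.
Proof. by case: (uvT (rng e)) => ->; rewrite ?eqxx. Qed.

Lemma lvertex_edge (I : set L) (e : edge E) : is_ideal I ->
  I (lvertex K (src e)) -> I (lvertex K (rng e)).
Proof.
by move=> iI; apply: (ideal_hereditary iI (p := [:: e])); rewrite /= !eqxx.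
Qed.

(** No vertex has to be killed here, since the generator at [u] is 0. *)
Lemma dvd_of_mem_v (x : pair) p :
  (forall e : edge E, reaches v (src e) -> reaches (rng e) v) ->
  prod_pred ku kv x -> x.1 = 0 ->
  ev_domain v p -> ideal_gen (gens (pair_fun x)) (ev v p) -> x.2 %| p.
Proof.
move=> ret xp x1; rewrite -(pair_fun_v x); apply: (@dvd_of_mem_gens _ _ _ set0%SET).
- exact: pair_fun_admissible.
- exact: hereditary_set0.
- exact: saturated_set0.
- by rewrite inE.
- by move=> w; case: (uvT w) => ->; rewrite ?eqxx // pair_fun_u; right.
by move=> e /ret.
Qed.

(** Since [u] is not [K1], its signature is 0 or 1, and it is 1 exactly when [v] lies in the ideal.
    The signature at [v] therefore carries all the information. *)
Lemma single_iso : ~ K1 u ->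
  (forall I : set L, is_ideal I -> (I (lvertex K u) <-> I (lvertex K v))) ->
  (forall e : edge E, reaches v (src e) -> reaches (rng e) v) ->
  order_iso (@lambda_le K E) (@pair_poset_le K (single_pred kv)).
Proof.
move=> nku Iuv ret; pose h (x : pair) : pair := ((x.2 == 1)%:R, x.2).
have chu (b : bool) : chain ku (b%:R : {poly K}) by case: b; rewrite ?chain0 ?chain1.
have hp x : single_pred kv x -> prod_pred ku kv (h x).
  by move=> /andP[_ xc]; rewrite /prod_pred chu.
have sig_u (I : set L) : is_ideal I -> signature I u = (signature I v == 1)%:R.
  move=> iI; have := chain_signature u iI; rewrite asboolF // => /andP[_ /= /orP[]/eqP su].
    rewrite su; case: eqP => // /(signature_vertex _ iI)/(Iuv _ iI)/(signature_vertex _ iI) su1.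
    by move/eqP: su; rewrite su1 oner_eq0.
  rewrite su; move/(signature_vertex _ iI)/(Iuv _ iI)/(signature_vertex _ iI): su => ->.
  by rewrite eqxx.
have hX x : [set w | pair_fun (h x) w == 1]%SET =
    if x.2 == 1 then [set: vertex E]%SET else set0%SET.
  apply/setP => w; rewrite !inE; case: (uvT w) => ->; rewrite ?pair_fun_u ?pair_fun_v /=.
    by case: (x.2 == 1); rewrite ?eqxx ?inE // eq_sym oner_eq0.
  by case: (x.2 == 1); rewrite inE.
have surj := @pair_fun_surj (single_pred kv) h hp.
have dv x p : single_pred kv x -> ev_domain v p ->
    ideal_gen (gens (pair_fun (h x))) (ev v p) -> x.2 %| p.
  move=> xs pd; have [->|x1] := eqVneq x.2 1; first by rewrite dvd1p.
  by apply: (@dvd_of_mem_v (h x)) => //; [exact: hp | rewrite /= (negbTE x1)].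
apply: (@iso_pair_poset _ (fun I => (1, signature I v))).
- by move=> x /andP[/eqP-> /chain_normal->]; rewrite normal_gen1.
- by move=> I /reducible_ideal iI; rewrite /single_pred eqxx chain_signature.
- move=> I J rI rJ; rewrite signature_pair_le // /pair_le /= dvdpp /=.
  rewrite !sig_u; try exact: reducible_ideal.
  split=> [/andP[]//|JI]; rewrite JI andbT; case: (signature I v =P 1) => [I1|_]; last exact: dvdp0.
  rewrite I1 in JI; rewrite (chain_eq1 (chain_signature v (reducible_ideal rJ)) JI).
  by rewrite eqxx dvdpp.
move=> x xs; have [||||I rI [_ Iv]] := surj _ _ _ _ x xs.
- by move=> y _; rewrite hX; case: ifP => _; [move=> ? ?; rewrite !inE | exact: hereditary_set0].
- by move=> y _; rewrite hX; case: ifP => _; [move=> ?; rewrite !inE | exact: saturated_set0].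
- move=> y p ys [//|/size1_polyC->]; rewrite evC => Iu.
  set c := p`_0 in Iu *; have [->|c0] := eqVneq c 0; first by rewrite dvdp0.
  have iG := ideal_gen_ideal (gens (K:=K) (pair_fun (h y))).
  rewrite /= (_ : y.2 == 1) ?dvd1p //.
  have /(dv _ _ ys) : ideal_gen (gens (pair_fun (h y))) (ev v 1).
    rewrite ev1; apply/(Iuv _ iG); rewrite -[lvertex K u]scale1r -(mulVf c0) -scalerA.
    exact: (is_idealZ iG).
  by move=> y1; case/andP: ys => _ /chain_eq1-> //; apply: y1; right; rewrite size_poly1.
- by move=> y p ys; exact: dv.
exists I => //; rewrite Iv; case/andP: xs => /eqP x1 _.
by rewrite [RHS]surjective_pairing x1.
Qed.

(** * No edge from [v] to [u] *)

Section NoReturn.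
Hypothesis vu : forall e : edge E, src e = v -> rng e = v.

Lemma hereditary_v : hereditary [set v].
Proof. by apply: hereditary_edge => e; rewrite !inE => /eqP/vu->. Qed.

Lemma no_return_v (e : edge E) : reaches v (src e) -> reaches (rng e) v.
Proof.
move=> ve; have : src e \in [set v]%SET by apply: hereditary_v ve; rewrite inE.
by rewrite inE => /eqP/vu->; exact: reaches_refl.
Qed.

(** Killing [v] removes its generator and leaves only loops at [u]. *)
Lemma dvd_of_mem_u (x : pair) p : saturated [set v] -> prod_pred ku kv x ->
  ev_domain u p -> ideal_gen (gens (pair_fun x)) (ev u p) -> x.1 %| p.
Proof.
move=> sv xp; rewrite -(pair_fun_u x); apply: (@dvd_of_mem_gens _ _ _ [set v]%SET).
- exact: pair_fun_admissible.
- exact: hereditary_v.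
- exact: sv.
- by rewrite inE.
- by move=> w; case: (uvT w) => ->; rewrite ?eqxx // inE eqxx; left.
by move=> e _; rewrite inE; case: (uvT (rng e)) => ->; rewrite ?eqxx // => _; exact: reaches_refl.
Qed.

(** Every set of vertices is hereditary and saturated, so either vertex can be killed to read off
    the coordinate at the other. *)
Lemma disconnected_iso : (forall e : edge E, src e = u -> rng e = u) ->
  order_iso (@lambda_le K E) (@pair_poset_le K (prod_pred ku kv)).
Proof.
move=> uu; have loop (e : edge E) : rng e = src e.
  by case: (uvT (src e)) => h; rewrite h; [exact: uu | exact: vu].
have H (X : {set vertex E}) : hereditary X by apply: hereditary_edge => e; rewrite loop.
have S (X : {set vertex E}) : saturated X by move=> w [e ew] /(_ e ew); rewrite loop ew.
apply: (@iso_pair_poset _ (fun I => (signature I u, signature I v))).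
- exact: normal_gen_prod.
- by move=> I /reducible_ideal iI; rewrite /prod_pred /= !chain_signature.
- exact: signature_pair_le.
apply: (@pair_fun_surj _ id) => // x p xp; first exact: dvd_of_mem_u.
rewrite -(pair_fun_v x); apply: (@dvd_of_mem_gens _ _ _ [set u]%SET) => //.
- exact: pair_fun_admissible.
- by rewrite inE eq_sym.
- by move=> w; case: (uvT w) => ->; rewrite ?eqxx // inE eqxx; left.
by move=> e _; rewrite inE => /rng_eq_v->; exact: reaches_refl.
Qed.

Variable a : edge E.
Hypotheses (au : src a = u) (av : rng a = v).

(** The exit [a] never returns, so it is not the first edge of the cycle and its ghost annihilates
    the cycle from the left. Sandwiching the generator between the ghost of [a] and [a] leaves its
    nonzero constant term times [v]. *)
Lemma signature_neq0_exit (I : set L) : is_ideal I -> K1 u -> signature I u <> 0 -> I (lvertex K v).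
Proof.
move=> iI k s0; have [sn _] := signature_admissible u iI; have Is := signature_mem u iI.
move: (signature I u) sn s0 Is => p /orP[/eqP->//|/andP[_ p0]] _ Ip.
have aC : lghost K a * path_elt K (cyc u) = 0 :> L.
  have := cycP k; case: (cyc u) => [|e q] //= /and3P[_ /= /andP[_ wq] _].
  rewrite path_elt_cons mulrA lghost_ledge; case: eqP => [ae|_]; last by rewrite mul0r.
  have : u \in [set v]%SET.
    by apply: (hereditary_v (v := v)); [rewrite inE | exists q; rewrite -av ae].
  by rewrite inE (negbTE uv).
have aV : lghost K a * lvertex K u * ledge K a = lvertex K v :> L.
  by rewrite -mulrA -{1}au ledge_src lghost_ledge eqxx av.
have : I (lghost K a * ev u p * ledge K a) by apply: is_idealMr => //; exact: is_idealMl.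
have [q pE] : exists q : {poly K}, p = q * 'X + (p`_0)%:P.
  exists (p %/ 'X); rewrite {1}(divp_eq p 'X); congr (_ + _).
  by rewrite -['X]subr0 -[0]/(0%:P) modp_XsubC horner_coef0.
rewrite {1}pE evD evXM // evC mulrDr mulrA aC mul0r add0r.
rewrite -leavitt_scalerAr -leavitt_scalerAl aV => Iv.
by rewrite -[lvertex K v]scale1r -(mulVf p0) -scalerA; exact: is_idealZ.
Qed.

(** The loop [c] keeps [v] alone saturated, so [v] can be killed without killing [u]. The coordinate
    at [v] matters only if it differs from 1; then the generator at [u] is 0 and nothing needs to be
    killed. *)
Lemma stack_iso (c : edge E) : src c = u -> rng c = u ->
  order_iso (@lambda_le K E) (@pair_poset_le K (stack_pred ku kv)).
Proof.
move=> cu cr.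
have sv : saturated [set v]%SET.
  move=> w _ h; case: (uvT w) => wE; rewrite wE inE ?eqxx //.
  by have := h c; rewrite wE cu cr inE; apply.
apply: (@iso_pair_poset _ (fun I => (signature I u, signature I v))).
- by move=> x /andP[/normal_gen_prod].
- move=> I /reducible_ideal iI; rewrite /stack_pred /prod_pred /= !chain_signature //=.
  case: eqP => //= s0; apply/eqP/(signature_vertex _ iI).
  have [k|nk] := pselect (K1 u); last first.
    have := chain_signature u iI; rewrite asboolF // => /andP[_ /= /orP[/eqP//|/eqP s1]].
    by rewrite -av; apply: lvertex_edge => //; rewrite au; apply/signature_vertex.
  exact: signature_neq0_exit k s0.
- exact: signature_pair_le.
apply: (@pair_fun_surj _ id).
- by move=> x /andP[].
- move=> x /andP[_ xc]; apply: hereditary_edge => e; rewrite !inE.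
  case: (uvT (src e)) => se; rewrite se; last by rewrite (vu se).
  rewrite pair_fun_u => /eqP x1; rewrite x1 oner_eq0 /= in xc.
  by case: (uvT (rng e)) => ->; rewrite ?pair_fun_u ?pair_fun_v ?x1.
- move=> x /andP[_ xc] w [e ew] h; case: (uvT w) => wE.
    by have := h c; rewrite wE cu cr; apply.
  by have := h _ ew; rewrite vu ?ew // wE.
- by move=> x p /andP[xp _]; exact: dvd_of_mem_u.
move=> x p /andP[xp xc]; have [->|x1] := eqVneq x.2 1; first by rewrite dvd1p.
apply: dvd_of_mem_v => //; first exact: no_return_v.
by case/orP: xc => /eqP // /eqP; rewrite (negbTE x1).
Qed.

(** By saturation and heredity the two vertices lie in the same ideals, and [u] lies on no closed
    path. *)
Lemma sink_iso : (forall e : edge E, src e = u -> rng e = v) ->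
  order_iso (@lambda_le K E) (@pair_poset_le K (single_pred kv)).
Proof.
move=> uv_only; apply: single_iso no_return_v.
  case=> [[|e p]] [] // /and3P[_ /= /andP[/eqP eu]].
  rewrite uv_only // => wp _ _; have : u \in [set v]%SET.
    by apply: (hereditary_v (v := v)); [rewrite inE | exists p].
  by rewrite inE (negbTE uv).
move=> I iI; split=> [Iu|Iv].
  by rewrite -av; apply: lvertex_edge; rewrite ?au.
apply: ideal_saturated => // [|e /uv_only->//]; by exists a.
Qed.

End NoReturn.
Section StronglyConnected.
Variables (a b : edge E).
Hypotheses (au : src a = u) (av : rng a = v) (bv : src b = v) (bu : rng b = u).

(** Moving the base point rotates the cycle: [b] times the [i]-th power of [ab] times [a] is the
    power [i+1] of [ba], whence the factor ['X]. *)
Lemma ev_two_cycle p : K1 u -> K1 v ->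
  ledge K b * ev u p * ledge K a = ev v (p * 'X) :> L.
Proof.
move=> k k'; have pu : path_elt K (cyc u) = ledge K a * ledge K b.
  by rewrite (two_cycle_cyc uv au av bv bu) // !path_elt_cons /path_elt big_nil mulr1.
have pv : path_elt K (cyc v) = ledge K b * ledge K a.
  rewrite (two_cycle_cyc _ bv bu au av) 1?eq_sym // !path_elt_cons.
  by rewrite /path_elt big_nil mulr1.
elim/poly_ind: p => [|p c IH]; first by rewrite mul0r !ev0 mulr0 mul0r.
rewrite evD evMX // evC pu mulrDr mulrDl [RHS]evMX // evD -IH evC mulrDl pv.
rewrite !mulrA -leavitt_scalerAr -!leavitt_scalerAl; congr (_ + _ *: _).
by rewrite -bu ledge_rng -bv ledge_src.
Qed.

End StronglyConnected.
End TwoVertices.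

(** The factor ['X] from the rotation is cancelled because the signature at [v] is normalised. By
    symmetry the two signatures agree. *)
Lemma two_cycle_transfer (K : fieldType) (E : fin_digraph) (u v : vertex E) (a b : edge E)
    (I : set (leavitt K E)) p :
  u != v -> (forall w, w = u \/ w = v) ->
  src a = u -> rng a = v -> src b = v -> rng b = u -> K1 u -> is_ideal I ->
  I (ev u p) -> I (ev v p).
Proof.
move=> uv uvT au av bv bu k iI Ip; have k' := two_cycle_K1 uv uvT au av bv bu k.
have [[sn _] sP] := signatureP v iI; apply/sP; first by left.
apply: normal_gen_dvdMX => //; apply/sP; first by left.
by rewrite -(ev_two_cycle uv au av bv bu) //; apply: is_idealMr => //; exact: is_idealMl.
Qed.

(** * Edges in both directions *)

Section StronglyConnected.
Variables (K : fieldType) (E : fin_digraph) (u v : vertex E) (a b : edge E).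
Hypotheses (uv : u != v) (uvT : forall w, w = u \/ w = v).
Hypotheses (au : src a = u) (av : rng a = v) (bv : src b = v) (bu : rng b = u).
Local Notation L := (leavitt K E).
Local Notation pair := ({poly K} * {poly K})%type.

Lemma two_cycle_iso : K1 u ->
  order_iso (@lambda_le K E) (@pair_poset_le K (single_pred true)).
Proof.
move=> ku; have kv := two_cycle_K1 uv uvT au av bv bu ku.
have vu : v != u by rewrite eq_sym.
have vuT w : w = v \/ w = u by case: (uvT w); auto.
have uvI (I : set L) p : is_ideal I -> I (ev u p) -> I (ev v p).
  exact: (two_cycle_transfer uv uvT au av bv bu).
have vuI (I : set L) p : is_ideal I -> I (ev v p) -> I (ev u p).
  exact: (two_cycle_transfer vu vuT bv bu au av).
pose h (x : pair) : pair := (x.2, x.2).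
have sig_uv (I : set L) : is_ideal I -> signature I u = signature I v.
  move=> iI; have [[un _] uP] := signatureP u iI; have [[vn _] vP] := signatureP v iI.
  apply: normal_gen_antisym => //.
    by apply/uP; [left | apply: vuI => //; exact: signature_mem].
  by apply/vP; [left | apply: uvI => //; exact: signature_mem].
have hp x : single_pred true x -> prod_pred `[< K1 u >] `[< K1 v >] (h x).
  by case/andP=> _ xc; rewrite /prod_pred !asboolT //= xc.
have hX (x : pair) : [set w | pair_fun u (h x) w == 1]%SET =
    if x.2 == 1 then [set: vertex E]%SET else set0%SET.
  by apply/setP => w; rewrite !inE /pair_fun if_same; case: (x.2 == 1); rewrite inE.
have dv x p : single_pred true x -> ideal_gen (gens (pair_fun u (h x))) (ev v p) -> x.2 %| p.
  (* The generator at [u] is redundant: by transfer it lies in the ideal generated at [v], so the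
     pair may be replaced by one with first coordinate 0. *)
  move=> xs; have yp : prod_pred `[< K1 u >] `[< K1 v >] (0, x.2).
    by case/andP: xs => _ xc; rewrite /prod_pred !asboolT //= chain0 xc.
  move=> Ip; apply: (dvd_of_mem_v uv uvT _ yp) => //.
  - by move=> e _; exact: two_cycle_reaches uvT au av bv bu _ _.
  - by left.
  apply: (_ : ideal_gen (gens (pair_fun u (h x))) `<=` _) Ip.
  have iG := ideal_gen_ideal (gens (K:=K) (pair_fun u (0, x.2))).
  have vG : ideal_gen (gens (pair_fun u (0, x.2))) (ev v x.2).
    by apply: sub_gen_smallest; exists v; rewrite (pair_fun_v uv).
  apply/ideal_genP => // y [w ->]; case: (uvT w) => ->.
    by rewrite pair_fun_u; exact: (vuI _ _ iG vG).
  by rewrite (pair_fun_v uv).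
have surj := @pair_fun_surj K E u v uv uvT (single_pred true) h hp.
apply: (@iso_pair_poset _ _ _ (fun I => (1, signature I v))).
- by move=> x /andP[/eqP-> /chain_normal->]; rewrite normal_gen1.
- move=> I /reducible_ideal iI; rewrite /single_pred eqxx /=.
  by have := chain_signature v iI; rewrite asboolT.
- move=> I J rI rJ; rewrite (signature_pair_le uvT) // /pair_le /= dvdpp /=.
  by rewrite !sig_uv ?andbb; try exact: reducible_ideal.
move=> x xs; have [||||I rI [_ Iv]] := surj _ _ _ _ x xs.
- by move=> y _; rewrite hX; case: ifP => _; [move=> ? ?; rewrite !inE | exact: hereditary_set0].
- by move=> y _; rewrite hX; case: ifP => _; [move=> ?; rewrite !inE | exact: saturated_set0].
- by move=> y p ys _ Ip; apply: dv => //; exact: (uvI _ _ (ideal_gen_ideal _) Ip).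
- by move=> y p ys _; exact: dv.
exists I => //; rewrite Iv; case/andP: xs => /eqP x1 _.
by rewrite [RHS]surjective_pairing x1.
Qed.

Lemma strongly_connected_iso : ~ K1 u ->
  order_iso (@lambda_le K E) (@pair_poset_le K (single_pred false)).
Proof.
move=> nku; have nkv : ~ K1 v.
  move=> kv; apply: nku; apply: (two_cycle_K1 _ _ bv bu au av) => //.
    by rewrite eq_sym.
  by move=> w; case: (uvT w); auto.
have := single_iso (K := K) uv uvT nku; rewrite asboolF //; apply.
  move=> I iI; split=> Iw.
    by rewrite -av; apply: lvertex_edge; rewrite ?au.
  by rewrite -bu; apply: lvertex_edge; rewrite ?bv.
by move=> e _; exact: two_cycle_reaches uvT au av bv bu _ _.
Qed.

End StronglyConnected.

Lemma two_vertex_iso (K : fieldType) (E : fin_digraph) : #|vertex E| = 2%N ->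
  exists i, order_iso (@lambda_le K E) (@pair_poset_le K (@form_pred K i)).
Proof.
move=> E2; have /cards2P[u [v [uv uvE]]] : #|[set: vertex E]%SET| == 2 by rewrite cardsT E2.
have {uvE} uvT w : w = u \/ w = v.
  by have := in_setT w; rewrite uvE !inE => /orP[]/eqP; auto.
have vu : v != u by rewrite eq_sym.
have vuT w : w = v \/ w = u by case: (uvT w); auto.
have no_edge x y : x != y -> (forall w, w = x \/ w = y) ->
    ~ (exists e : edge E, src e = x /\ rng e = y) -> forall e : edge E, src e = x -> rng e = x.
  by move=> xy xyT nex e ex; case: (xyT (rng e)) => // ey; case: nex; exists e.
have one_way x y : x != y -> (forall w, w = x \/ w = y) ->
    (exists e : edge E, src e = x /\ rng e = y) ->
    ~ (exists e : edge E, src e = y /\ rng e = x) ->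
    exists i, order_iso (@lambda_le K E) (@pair_poset_le K (@form_pred K i)).
  move=> xy xyT [a [ax ay]] nyx.
  have yy : forall e : edge E, src e = y -> rng e = y.
    by move=> e ey; case: (xyT (rng e)) => // ex; case: nyx; exists e.
  case: (pselect (exists c : edge E, src c = x /\ rng c = x)) => [[c [cx cr]]|nl].
    have := stack_iso K xy xyT yy ax ay cx cr.
    by case: `[< K1 x >] `[< K1 y >] => [] [] h;
      [exists FIV | exists FIII | exists FVI | exists FV]; exact: h.
  have := sink_iso K xy xyT yy ax ay; case: `[< K1 y >] => h.
    by exists FII; apply: h => e ex; case: (xyT (rng e)) => // er; case: nl; exists e.
  by exists FI; apply: h => e ex; case: (xyT (rng e)) => // er; case: nl; exists e.
case: (pselect (exists e : edge E, src e = u /\ rng e = v)) => [euv|nuv];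
  case: (pselect (exists e : edge E, src e = v /\ rng e = u)) => [evu|nvu].
- case: euv evu => a [au av] [b [bv bu]]; case: (pselect (K1 u)) => k.
    by exists FII; exact: two_cycle_iso uv uvT au av bv bu k.
  by exists FI; exact: strongly_connected_iso uv uvT au av bv bu k.
- exact: one_way uv uvT euv nvu.
- exact: one_way vu vuT evu nuv.
have uu := no_edge _ _ uv uvT nuv; have vv := no_edge _ _ vu vuT nvu.
(* Both orders of the vertices are kept, because [FVIII] expects the [K1] vertex in the first
   coordinate. *)
have := disconnected_iso K uv uvT vv uu; have := disconnected_iso K vu vuT uu vv.
case: `[< K1 u >] `[< K1 v >] => [] [] h h';
  [exists FIX | exists FVIII | exists FVIII | exists FVII]; first [exact: h | exact: h'].
Qed.

(** * The nine forms *)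

Section FormPosets.
Variable K : fieldType.
Local Notation pair := ({poly K} * {poly K})%type.
Local Notation Q := (Qpoly K).

Lemma Qpoly_inj (p q : Q) : sval p = sval q -> p = q. Proof. exact: val_inj. Qed.
Lemma Qpoly_monic (q : Q) : sval q \is monic. Proof. by case: q => q /= /and3P[]. Qed.
Lemma Qpoly_size (q : Q) : (1 < size (sval q))%N. Proof. by case: q => q /= /and3P[]. Qed.
Lemma Qpoly_coef0 (q : Q) : (sval q)`_0 != 0. Proof. by case: q => q /= /and3P[]. Qed.

Lemma Qpoly_eq0 (q : Q) : (sval q == 0) = false.
Proof. exact/negbTE/monic_neq0/Qpoly_monic. Qed.
Lemma Qpoly_dvd1 (q : Q) : (sval q %| 1) = false.
Proof.
by rewrite dvdp1; apply/negbTE; rewrite neq_ltn Qpoly_size orbT.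
Qed.
Lemma Qpoly_eq1 (q : Q) : (sval q == 1) = false.
Proof. by apply: contraFF (Qpoly_dvd1 q) => /eqP->; exact: dvdpp. Qed.
Lemma Qpoly_0eq (q : Q) : (0 == sval q) = false.
Proof. by rewrite eq_sym Qpoly_eq0. Qed.
Lemma Qpoly_1eq (q : Q) : (1 == sval q) = false.
Proof. by rewrite eq_sym Qpoly_eq1. Qed.
Lemma Qpoly_0dvd (q : Q) : (0 %| sval q) = false.
Proof. by rewrite dvd0p Qpoly_eq0. Qed.
Lemma poly_0dvd1 : (0 %| (1 : {poly K})) = false.
Proof. by rewrite dvd0p oner_eq0. Qed.
Lemma poly_0eq1 : (0 == 1 :> {poly K}) = false.
Proof. by rewrite eq_sym oner_eq0. Qed.

Definition QpolyE := (Qpoly_eq0, Qpoly_eq1, Qpoly_0eq, Qpoly_1eq, Qpoly_0dvd,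
  Qpoly_dvd1, poly_0dvd1, poly_0eq1, oner_eq0, dvdp0, dvd1p, dvdpp, eqxx).

Lemma Qpoly_normal (q : Q) : normal_gen (sval q).
Proof. by apply/orP; right; rewrite Qpoly_monic Qpoly_coef0. Qed.

Lemma chain_Qpoly (q : Q) : chain true (sval q).
Proof. by rewrite /chain Qpoly_normal. Qed.

Lemma qdvd_refl (q : Q) : qdvd q q. Proof. exact: dvdpp. Qed.

Fact XsubC1_Qpoly (p := 'X - 1%:P : {poly K}) :
  [&& p \is monic, (1 < size p)%N & p`_0 != 0].
Proof.
by rewrite monicXsubC size_XsubC coefB coefX coefC sub0r oppr_eq0 oner_eq0.
Qed.
Definition Qpoly_XsubC1 : Q := exist _ ('X - 1%:P) XsubC1_Qpoly.

Lemma chainP k g : chain k g -> [\/ g = 0, g = 1 | k /\ exists q : Q, g = sval q].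
Proof.
case/andP=> gn; have [->|g0] := eqVneq g 0; first by constructor 1.
have [->|g1] := eqVneq g 1; first by constructor 2.
rewrite !orbF => kT; constructor 3; split=> //.
case/orP: gn => [g00|/andP[gm gc]]; first by rewrite g00 in g0.
suff gQ : [&& g \is monic, (1 < size g)%N & g`_0 != 0] by exists (exist _ g gQ).
by rewrite gm gc normal_gen_size.
Qed.

Definition form_pair (i : lattice_form) : form_elt K i -> pair :=
  match i with
  | FI => fun x => match x with I_0 => (1, 0) | I_L => (1, 1) end
  | FII => fun x => match x with II_0 => (1, 0) | II_p p => (1, sval p) | II_L => (1, 1) end
  | FIII => fun x => match x with
      III_0 => (0, 0) | III_v => (0, 1) | III_p p => (sval p, 1) | III_L => (1, 1) end
  | FIV => fun x => match x with
      IV_0 => (0, 0) | IV_pf p => (0, sval p) | IV_v => (0, 1)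
    | IV_qe q => (sval q, 1) | IV_L => (1, 1) end
  | FV => fun x => match x with V_0 => (0, 0) | V_v => (0, 1) | V_L => (1, 1) end
  | FVI => fun x => match x with
      VI_0 => (0, 0) | VI_p p => (0, sval p) | VI_v => (0, 1) | VI_L => (1, 1) end
  | FVII => fun x => match x with
      VII_0 => (0, 0) | VII_u => (1, 0) | VII_v => (0, 1) | VII_L => (1, 1) end
  | FVIII => fun x => match x with
      VIII_0 => (0, 0) | VIII_p p => (sval p, 0) | VIII_u => (1, 0)
    | VIII_v => (0, 1) | VIII_pv p => (sval p, 1) | VIII_L => (1, 1) end
  | FIX => fun x => match x with
      IX_0 => (0, 0) | IX_p p => (sval p, 0) | IX_q q => (0, sval q)
    | IX_pq p q => (sval p, sval q) | IX_u => (1, 0) | IX_v => (0, 1)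
    | IX_pv p => (sval p, 1) | IX_uq q => (1, sval q) | IX_L => (1, 1) end
  end.

Lemma form_pair_pred i (x : form_elt K i) : form_pred i (form_pair x).
Proof.
case: i x => /= [] []; intros; rewrite /single_pred /stack_pred /prod_pred /=;
  by rewrite ?chain0 ?chain1 ?chain_Qpoly ?QpolyE ?orbT.
Qed.

Lemma form_pair_inj i : injective (@form_pair i).
Proof.
move=> x y xy; have {xy} : ((form_pair x).1 == (form_pair y).1) &&
    ((form_pair x).2 == (form_pair y).2) by rewrite xy !eqxx.
case: i x y => x y; destruct x; destruct y; rewrite /= ?QpolyE ?andbT ?andbF //.
all: by [move=> /eqP/Qpoly_inj-> | move=> /andP[/eqP/Qpoly_inj-> /eqP/Qpoly_inj->]].
Qed.

Lemma form_pair_surj i (x : pair) : form_pred i x -> exists y : form_elt K i, form_pair y = x.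
Proof.
case: x => a b; case: i; rewrite /= /single_pred /stack_pred /prod_pred /=.
- by case/andP=> /eqP-> /chainP[->|->|[]] //; [exists I_0 | exists I_L].
- by case/andP=> /eqP-> /chainP[->|->|[_ [q ->]]]; 
    [exists (II_0 K) | exists (II_L K) | exists (II_p q)].
- case/andP=> /andP[/chainP[->|->|[_ [p ->]]] /chainP[->|->|[]]] //; rewrite ?QpolyE //= => _;
  by [exists (III_0 K) | exists (III_v K) | exists (III_L K) | exists (III_p p)].
- case/andP=> /andP[/chainP[->|->|[_ [p ->]]] /chainP[->|->|[_ [q ->]]]]; rewrite ?QpolyE //= => _;
  by [exists (IV_0 K) | exists (IV_v K) | exists (IV_pf q) | exists (IV_L K) | exists (IV_qe p)].
- case/andP=> /andP[/chainP[->|->|[]] // /chainP[->|->|[]]] //; rewrite ?QpolyE //= => _;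
  by [exists V_0 | exists V_v | exists V_L].
- case/andP=> /andP[/chainP[->|->|[]] // /chainP[->|->|[_ [q ->]]]]; rewrite ?QpolyE //= => _;
  by [exists (VI_0 K) | exists (VI_v K) | exists (VI_p q) | exists (VI_L K)].
- case/andP=> /chainP[->|->|[]] // /chainP[->|->|[]] //;
  by [exists VII_0 | exists VII_v | exists VII_u | exists VII_L].
- case/andP=> /chainP[->|->|[_ [p ->]]] /chainP[->|->|[]] //;
  by [exists (VIII_0 K) | exists (VIII_v K) | exists (VIII_u K) | exists (VIII_L K)
     | exists (VIII_p p) | exists (VIII_pv p)].
- case/andP=> /chainP[->|->|[_ [p ->]]] /chainP[->|->|[_ [q ->]]];
  by [exists (IX_0 K) | exists (IX_v K) | exists (IX_q q) | exists (IX_u K) | exists (IX_L K)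
     | exists (IX_uq q) | exists (IX_p p) | exists (IX_pv p) | exists (IX_pq p q)].
Qed.

Lemma form_gen_pair_le i (x y : form_elt K i) :
  form_gen x y -> pair_le (form_pair x) (form_pair y).
Proof.
by case: i x y => x y; case; intros; rewrite /pair_le /= ?QpolyE //=; apply/andP.
Qed.

Lemma form_le_pair_le i (x y : form_elt K i) :
  form_le K i x y -> pair_le (form_pair x) (form_pair y).
Proof.
elim=> [a b|a|a b c _ ab _ bc]; first exact: form_gen_pair_le.
  exact: pair_le_refl.
exact: pair_le_trans ab bc.
Qed.

(** Searches for a path of at most [n + 1] displayed containments. *)
Ltac form_chain n :=
  first
  [ solve [apply rt_refl]
  | solve [apply rt_step; constructor; solve [assumption | apply qdvd_refl]]
  | lazymatch n with
    | S ?m => solve [eapply rt_trans;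
        [apply rt_step; econstructor; solve [eassumption | apply qdvd_refl] | form_chain m]]
    end ].

Lemma pair_le_form_le i (x y : form_elt K i) :
  pair_le (form_pair x) (form_pair y) -> form_le K i x y.
Proof.
rewrite /pair_le /form_le; case: i x y => x y; destruct x; destruct y;
  rewrite /= ?QpolyE ?andbT ?andbF //; try case/andP; intros.
(* Going from bottom to top in [FIV] and [FIX] takes four containments. *)
all: first [form_chain 0%N | form_chain 1%N | form_chain 2%N | form_chain 3%N].
(* A path crossing a family may leave the member undetermined; any polynomial will do. *)
Unshelve.
all: exact: Qpoly_XsubC1.
Qed.

Lemma form_leP i (x y : form_elt K i) :
  form_le K i x y <-> pair_le (form_pair x) (form_pair y).
Proof. by split; [exact: form_le_pair_le | exact: pair_le_form_le]. Qed.

Lemma form_iso i : order_iso (form_le K i) (@pair_poset_le K (@form_pred K i)).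
Proof.
exists (fun x => exist (@form_pred K i) _ (form_pair_pred x)); split; last exact: form_leP.
apply: bijective_inj_surj => [x y [] /form_pair_inj //|[x xP]].
by have [y yx] := form_pair_surj xP; exists y; exact: eq_exist.
Qed.

End FormPosets.

(** * Examples and order invariants *)

Section Examples.

Lemma closed_simple_path_loop (E : fin_digraph) (w : vertex E) p :
  (forall e : edge E, src e = w -> reaches (rng e) w -> rng e = w) ->
  closed_simple_path w p <-> exists2 e : edge E, src e = w /\ rng e = w & p = [:: e].
Proof.
move=> ret; split=> [|[e [ew rw] ->]]; last first.
  by rewrite /closed_simple_path /= ew rw !eqxx.
case: p => [|e q] //= /and3P[_ /= /andP[/eqP ew wq] aq].
have rw : rng e = w by apply: ret => //; exists q.
exists e => //; case: q wq aq => [//|e' q] /= /andP[/eqP->].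
by rewrite rw eqxx.
Qed.

Lemma K1_loop (E : fin_digraph) (w : vertex E) :
  (forall e : edge E, src e = w -> reaches (rng e) w -> rng e = w) ->
  K1 w <-> exists! e : edge E, src e = w /\ rng e = w.
Proof.
move=> ret; have cP p := closed_simple_path_loop p ret; split.
  case=> p [/cP[e ew ->] u]; exists e; split=> // e' ew'.
  by have [] : [:: e] = [:: e'] by apply/u/cP; exists e'.
case=> e [ew u]; exists [:: e]; split; first by apply/cP; exists e.
by move=> p /cP[e' /u-> ->].
Qed.

(* [a] loops at [true], [b] loops at [false], [c] edges from [true] to [false]. *)
Definition arrow_graph (a b c : nat) : fin_digraph :=
  @FinDigraph bool ('I_a + 'I_b + 'I_c)%type
    (fun e => if e is inl (inr _) then false else true)
    (fun e => if e is inl (inl _) then true else false).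

Lemma exists_unique_ord (T : Type) n (f : 'I_n -> T) (P : T -> Prop) :
  injective f -> (forall x, P x <-> exists i, x = f i) ->
  `[< exists! x, P x >] = (n == 1%N).
Proof.
move=> fi Pf; apply/asboolP/eqP => [[x [/Pf[i xi] u]]|n1].
  case: n f fi Pf i xi u => [|[|n]] f fi Pf i xi u //; first by case: i {xi}.
  have e0 : x = f ord0 by apply/u/Pf; exists ord0.
  have e1 : x = f ord_max by apply/u/Pf; exists ord_max.
  by move: e0; rewrite e1 => /fi.
rewrite n1 in f fi Pf *; exists (f ord0); split; first by apply/Pf; exists ord0.
by move=> y /Pf[i ->]; rewrite (ord1 i).
Qed.

Section Arrow.
Variables a b c : nat.
Local Notation E := (arrow_graph a b c).

Lemma arrow_vertices (w : vertex E) : w = true \/ w = false.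
Proof. by case: w; auto. Qed.

Lemma arrow_no_return (e : edge E) : src e = false :> bool -> rng e = false :> bool.
Proof. by case: e => [[]|]. Qed.

Lemma arrow_K1_true : `[< @K1 E true >] = (a == 1%N).
Proof.
rewrite -(@exists_unique_ord (edge E) a (fun i => inl (inl i))
  (fun e => src e = true :> bool /\ rng e = true :> bool)).
- apply: asbool_equiv_eq; apply: K1_loop => e _ [p].
  case: (arrow_vertices (rng e)) => -> // wp.
  have : true \in [set false]%SET :> bool.
    apply: (hereditary_v (E := E) (v := false) arrow_no_return); first by rewrite inE.
    by exists p; exact: wp.
  by rewrite inE.
- by move=> i j [].
by case=> [[i|i]|i]; split=> [[]|[j]] //; exists i.
Qed.

Lemma arrow_K1_false : `[< @K1 E false >] = (b == 1%N).
Proof.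
rewrite -(@exists_unique_ord (edge E) b (fun i => inl (inr i))
  (fun e => src e = false :> bool /\ rng e = false :> bool)).
- by apply: asbool_equiv_eq; apply: K1_loop => e ef _; exact: arrow_no_return.
- by move=> i j [].
by case=> [[i|i]|i]; split=> [[]|[j]] //; exists i.
Qed.

End Arrow.

Lemma form_example (K : fieldType) i : exists E : fin_digraph,
  #|vertex E| = 2%N /\ order_iso (@lambda_le K E) (@pair_poset_le K (@form_pred K i)).
Proof.
have tf : true != false by [].
have disc a b := @disconnected_iso K (arrow_graph a b 0) true false tf
  (@arrow_vertices a b 0) (@arrow_no_return a b 0).
have stack a b := @stack_iso K (arrow_graph a.+1 b 1) true false tf
  (@arrow_vertices _ _ _) (@arrow_no_return _ _ _) (inr ord0) erefl erefl
  (inl (inl ord0)) erefl erefl.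
have sink b := @sink_iso K (arrow_graph 0 b 1) true false tf
  (@arrow_vertices _ _ _) (@arrow_no_return _ _ _) (inr ord0) erefl erefl.
have {}disc a b : order_iso (@lambda_le K (arrow_graph a b 0))
    (@pair_poset_le K (prod_pred (a == 1%N) (b == 1%N))).
  rewrite -(arrow_K1_true a b 0) -(arrow_K1_false a b 0).
  by apply: disc => -[[]|[]].
have {}stack a b : order_iso (@lambda_le K (arrow_graph a.+1 b 1))
    (@pair_poset_le K (stack_pred (a.+1 == 1%N) (b == 1%N))).
  by rewrite -(arrow_K1_true a.+1 b 1) -(arrow_K1_false a.+1 b 1); exact: stack.
have {}sink b : order_iso (@lambda_le K (arrow_graph 0 b 1))
    (@pair_poset_le K (single_pred (b == 1%N))).
  by rewrite -(arrow_K1_false 0 b 1); apply: sink => -[[[]|]|].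
have two a b c : #|vertex (arrow_graph a b c)| = 2%N by exact: card_bool.
case: i.
- by exists (arrow_graph 0 0 1); split; [|exact: sink].
- by exists (arrow_graph 0 1 1); split; [|exact: sink].
- by exists (arrow_graph 1 0 1); split; [|exact: stack].
- by exists (arrow_graph 1 1 1); split; [|exact: stack].
(* Two loops provide the loop that [stack] requires while keeping the vertex from being [K1]. *)
- by exists (arrow_graph 2 0 1); split; [|exact: stack].
- by exists (arrow_graph 2 1 1); split; [|exact: stack].
- by exists (arrow_graph 0 0 0); split; [|exact: disc].
- by exists (arrow_graph 1 0 0); split; [|exact: disc].
- by exists (arrow_graph 1 1 0); split; [|exact: disc].
Qed.

End Examples.

(** * Order invariants *)

Section Invariants.
Variables (T : Type) (le : T -> T -> Prop).

(** Here and below, least and greatest elements are expressed by comparison with every element. The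
    invariants thus mention nothing but the relation and pass through any order isomorphism. *)
Definition has_atom := exists a, (exists y, ~ le a y) /\
  forall x, le x a -> le a x \/ (forall y, le x y).
Definition has_greatest_proper := exists m, (exists y, ~ le y m) /\
  forall x, le x m \/ (forall y, le y x).
Definition has_cut := exists c, [/\ exists y, ~ le y c, exists y, ~ le c y &
  forall x, le x c \/ le c x].
Definition has_disjoint := exists x y, [/\ exists z, ~ le x z, exists z, ~ le y z &
  forall z, le z x -> le z y -> forall t, le z t].
Definition has_chain4 := exists a b c d,
  [/\ le a b, le b c, le c d & [/\ ~ le b a, ~ le c b & ~ le d c]].
End Invariants.

Section Transport.
Variables (T U : Type) (leT : T -> T -> Prop) (leU : U -> U -> Prop).
Hypothesis iso : order_iso leT leU.

Lemma order_iso_inv : exists (f : T -> U) (g : U -> T),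
  [/\ forall x y, leT x y <-> leU (f x) (f y), forall x y, leU x y <-> leT (g x) (g y),
      forall x y, leT (g x) y <-> leU x (f y) & forall x y, leT x (g y) <-> leU (f x) y].
Proof.
case: iso => f [[g fK gK] emb]; exists f, g; split=> // x y; rewrite ?emb ?gK //.
Qed.

Lemma has_atom_iso : has_atom leT -> has_atom leU.
Proof.
have [f [g [ef eg gf fg]]] := order_iso_inv.
case=> a [[y ay] h]; exists (f a); split; first by exists (f y) => /ef.
by move=> x /gf/h[/fg|hx]; [left | right=> z; apply/eg].
Qed.

Lemma has_greatest_proper_iso : has_greatest_proper leT -> has_greatest_proper leU.
Proof.
have [f [g [ef eg gf fg]]] := order_iso_inv.
case=> a [[y ay] h]; exists (f a); split; first by exists (f y) => /ef.
by move=> x; case: (h (g x)) => [/gf|hx]; [left | right=> z; apply/eg].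
Qed.

Lemma has_cut_iso : has_cut leT -> has_cut leU.
Proof.
have [f [g [ef eg gf fg]]] := order_iso_inv.
case=> a [[y ay] [z az] h]; exists (f a); split; [by exists (f y) => /ef|by exists (f z) => /ef|].
by move=> x; case: (h (g x)) => [/gf|/fg]; [left | right].
Qed.

Lemma has_disjoint_iso : has_disjoint leT -> has_disjoint leU.
Proof.
have [f [g [ef eg gf fg]]] := order_iso_inv.
case=> x [y [[z xz] [t yt] h]]; exists (f x), (f y).
split; [by exists (f z) => /ef|by exists (f t) => /ef|].
by move=> s /gf sx /gf sy r; apply/eg; exact: h.
Qed.

Lemma has_chain4_iso : has_chain4 leT -> has_chain4 leU.
Proof.
have [f [g [ef eg gf fg]]] := order_iso_inv.
case=> a [b [c [d [ab bc cd [ba cb dc]]]]]; exists (f a), (f b), (f c), (f d).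
by split; first [exact/ef | split=> /ef].
Qed.
End Transport.

(** * Separating the nine forms *)

Section Distinct.
Variable K : fieldType.
Local Notation Q := (Qpoly K).

Fact Qpoly_mul_subproof (p q : Q) (r := sval p * sval q) :
  [&& r \is monic, (1 < size r)%N & r`_0 != 0].
Proof.
rewrite monicMl ?Qpoly_monic // size_monicM ?Qpoly_monic ?monic_neq0 ?Qpoly_monic //.
rewrite coef0M mulf_neq0 ?Qpoly_coef0 // andbT /=.
move: (Qpoly_size p) (Qpoly_size q).
by move: (size (sval p)) (size (sval q)) => [|[|k]] [|[|l]] // _ _; rewrite !addSn !addnS.
Qed.
(** A common lower bound of two members of a family, strictly below the first. *)
Definition Qpoly_mul (p q : Q) : Q := exist _ (sval p * sval q) (Qpoly_mul_subproof p q).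

Fact Qpoly_coprime_subproof (p : Q) (r := sval p * 'X + 1%:P) :
  [&& r \is monic, (1 < size r)%N & r`_0 != 0].
Proof.
have p0 : sval p != 0 by rewrite Qpoly_eq0.
have sp := Qpoly_size p; have sX : size (sval p * 'X) = (size (sval p)).+1 by rewrite size_mulX.
rewrite monicE lead_coefDl ?size_polyC ?oner_eq0 ?sX ?ltnS ?(ltnW sp) //.
rewrite lead_coefMX -monicE Qpoly_monic size_polyDl ?size_polyC ?oner_eq0 ?sX ?ltnS ?(ltnW sp) //=.
by rewrite coefD coefMX coefC eqxx add0r oner_eq0.
Qed.
(** A member of the family incomparable with [p]: it has larger degree, and it leaves remainder 1
    modulo [p]. *)
Definition Qpoly_coprime (p : Q) : Q :=
  exist _ (sval p * 'X + 1%:P) (Qpoly_coprime_subproof p).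

Lemma Qpoly_mul_dvd (p q : Q) : (sval (Qpoly_mul p q) %| sval p) = false.
Proof.
apply/negbTE/negP => /(dvdp_leq (monic_neq0 (Qpoly_monic p))) /=.
rewrite size_monicM ?Qpoly_monic ?monic_neq0 ?Qpoly_monic //.
have := Qpoly_size q; case: (size (sval q)) => [|[|k]] // _.
by rewrite !addnS /= ltnNge leq_addr.
Qed.
Lemma Qpoly_dvd_mull (p q : Q) : sval p %| sval (Qpoly_mul p q).
Proof. exact: dvdp_mulIl. Qed.
Lemma Qpoly_dvd_mulr (p q : Q) : sval q %| sval (Qpoly_mul p q).
Proof. exact: dvdp_mulIr. Qed.
Lemma Qpoly_coprime_dvdl (p : Q) : (sval (Qpoly_coprime p) %| sval p) = false.
Proof.
apply/negbTE/negP => /(dvdp_leq (monic_neq0 (Qpoly_monic p))) /=.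
have p0 : sval p != 0 by rewrite Qpoly_eq0.
by rewrite size_polyDl size_mulX ?size_polyC ?oner_eq0 ?ltnn // ltnS ltnW // Qpoly_size.
Qed.
Lemma Qpoly_coprime_dvdr (p : Q) : (sval p %| sval (Qpoly_coprime p)) = false.
Proof. by rewrite /= dvdp_addr ?dvdp_mulIl // Qpoly_dvd1. Qed.

Definition QdvdE := (Qpoly_mul_dvd, Qpoly_dvd_mull, Qpoly_dvd_mulr,
  Qpoly_coprime_dvdl, Qpoly_coprime_dvdr).


(** The order in computed form, so that instances reduce by rewriting instead of by inverting a
    transitive closure. *)
Definition form_leb i (x y : form_elt K i) : Prop := pair_le (form_pair x) (form_pair y).
Local Notation p0 := (Qpoly_XsubC1 K).

Ltac form_simp := rewrite /form_leb /pair_le; cbn [form_pair fst snd];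
  rewrite ?QdvdE ?QpolyE ?andbF ?andbT.

Ltac refute h x bot := case: (h x); form_simp => //; move/(_ bot); form_simp => //.
Ltac refute_extreme H := let y := fresh in
  case: H => y; exfalso; move: H; case: y => *; form_simp.

Definition atomic_form i := match i with
  FI | FIII | FV | FVII | FVIII => true | _ => false end.

(** A family just above the bottom has no minimal member, since any member can be multiplied
    further. The atomic forms are those in which some nonzero element lies above no such member. *)
Lemma has_atom_form i : has_atom (@form_leb i) <-> atomic_form i.
Proof.
case: i => /=; split=> //.
- move=> _; exists I_L; split; first by exists I_0; form_simp.
  by case; [right; case; form_simp | left; form_simp].
- case=> m [[y ym] h]; case: m ym h => [|p|] ym h.
  + by case: ym; case: y; intros; form_simp.
  + by refute h (II_p (Qpoly_mul p p0)) (II_0 K).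
  + by refute h (II_p p0) (II_0 K).
- move=> _; exists (III_v K); split; first by exists (III_0 K); form_simp.
  by case=> [||p|]; [right; case => *; form_simp | left; form_simp..].
- case=> m [[y ym] h]; case: m ym h => [|p||q|] ym h.
  + by case: ym; case: y; intros; form_simp.
  + by refute h (IV_pf (Qpoly_mul p p0)) (IV_0 K).
  + by refute h (IV_pf p0) (IV_0 K).
  + by refute h (IV_pf p0) (IV_0 K).
  + by refute h (IV_pf p0) (IV_0 K).
- move=> _; exists V_v; split; first by exists V_0; form_simp.
  by case; [right; case => *; form_simp | left; form_simp..].
- case=> m [[y ym] h]; case: m ym h => [|p||] ym h.
  + by case: ym; case: y; intros; form_simp.
  + by refute h (VI_p (Qpoly_mul p p0)) (VI_0 K).
  + by refute h (VI_p p0) (VI_0 K).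
  + by refute h (VI_p p0) (VI_0 K).
- move=> _; exists VII_v; split; first by exists VII_0; form_simp.
  by case; first [by form_simp | by left; form_simp | by right; case => *; form_simp].
- move=> _; exists (VIII_v K); split; first by exists (VIII_0 K); form_simp.
  by case=> [|p|||p|]; first [by form_simp | by left; form_simp | by right; case => *; form_simp].
- case=> m [[y ym] h]; case: m ym h => [|p|q|p q|||p|q|] ym h.
  + by case: ym; case: y; intros; form_simp.
  + by refute h (IX_p (Qpoly_mul p p0)) (IX_0 K).
  + by refute h (IX_q (Qpoly_mul q p0)) (IX_0 K).
  + by refute h (IX_p p) (IX_0 K).
  + by refute h (IX_p p0) (IX_0 K).
  + by refute h (IX_q p0) (IX_0 K).
  + by refute h (IX_p p) (IX_0 K).
  + by refute h (IX_q q) (IX_0 K).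
  + by refute h (IX_p p0) (IX_0 K).
Qed.

Definition local_form i := match i with FI | FV | FVI => true | _ => false end.

(** A family just below the top has no greatest member because of [Qpoly_coprime]; in [FVII] and
    beyond two incomparable branches reach the top. *)
Lemma has_greatest_proper_form i : has_greatest_proper (@form_leb i) <-> local_form i.
Proof.
case: i => /=; split=> //.
- move=> _; exists I_0; split; first by exists I_L; form_simp.
  by case; [left; form_simp | right; case; form_simp].
- case=> m [[y ym] h]; case: m ym h => [|p|] ym h.
  + by refute h (II_p p0) (II_L K).
  + by refute h (II_p (Qpoly_coprime p)) (II_L K).
  + by case: ym; case: y; intros; form_simp.
- case=> m [[y ym] h]; case: m ym h => [||p|] ym h.
  + by refute h (III_p p0) (III_L K).
  + by refute h (III_p p0) (III_L K).
  + by refute h (III_p (Qpoly_coprime p)) (III_L K).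
  + by case: ym; case: y; intros; form_simp.
- case=> m [[y ym] h]; case: m ym h => [|q||p|] ym h.
  + by refute h (IV_qe p0) (IV_L K).
  + by refute h (IV_qe p0) (IV_L K).
  + by refute h (IV_qe p0) (IV_L K).
  + by refute h (IV_qe (Qpoly_coprime p)) (IV_L K).
  + by case: ym; case: y; intros; form_simp.
- move=> _; exists V_v; split; first by exists V_L; form_simp.
  by case; [left; form_simp.. | right; case; form_simp].
- move=> _; exists (VI_v K); split; first by exists (VI_L K); form_simp.
  by case=> [|p||]; [left; form_simp.. | right; case => *; form_simp].
- case=> m [[y ym] h]; case: m ym h => [|||] ym h.
  + by refute h VII_u VII_L.
  + by refute h VII_v VII_L.
  + by refute h VII_u VII_L.
  + by case: ym; case: y; intros; form_simp.
- case=> m [[y ym] h]; case: m ym h => [|p|||p|] ym h.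
  + by refute h (VIII_u K) (VIII_L K).
  + by refute h (VIII_v K) (VIII_L K).
  + by refute h (VIII_v K) (VIII_L K).
  + by refute h (VIII_u K) (VIII_L K).
  + by refute h (VIII_u K) (VIII_L K).
  + by case: ym; case: y; intros; form_simp.
- case=> m [[y ym] h]; case: m ym h => [|p|q|p q|||p|q|] ym h.
  + by refute h (IX_u K) (IX_L K).
  + by refute h (IX_v K) (IX_L K).
  + by refute h (IX_u K) (IX_L K).
  + by refute h (IX_u K) (IX_L K).
  + by refute h (IX_v K) (IX_L K).
  + by refute h (IX_u K) (IX_L K).
  + by refute h (IX_u K) (IX_L K).
  + by refute h (IX_v K) (IX_L K).
  + by case: ym; case: y; intros; form_simp.
Qed.

Definition cut_form i := match i with FIII | FIV | FV | FVI => true | _ => false end.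

Ltac incomparable h x := by case: (h x); form_simp.

Lemma has_cut_form i : has_cut (@form_leb i) <-> cut_form i.
Proof.
case: i => /=; split=> //.
- case=> m [[y ym] [z zm] h]; case: m ym zm h => ym zm h.
  + by case: zm; case: z; intros; form_simp.
  + by case: ym; case: y; intros; form_simp.
- case=> m [[y ym] [z zm] h]; case: m ym zm h => [|p|] ym zm h.
  + by case: zm; case: z; intros; form_simp.
  + incomparable h (II_p (Qpoly_coprime p)).
  + by case: ym; case: y; intros; form_simp.
- move=> _; exists (III_v K).
  split; [by exists (III_L K); form_simp|by exists (III_0 K); form_simp|].
  by case=> *; first [by left; form_simp | by right; form_simp].
- move=> _; exists (IV_v K); split; [by exists (IV_L K); form_simp|by exists (IV_0 K); form_simp|].
  by case=> *; first [by left; form_simp | by right; form_simp].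
- move=> _; exists V_v; split; [by exists V_L; form_simp|by exists V_0; form_simp|].
  by case=> *; first [by left; form_simp | by right; form_simp].
- move=> _; exists (VI_v K); split; [by exists (VI_L K); form_simp|by exists (VI_0 K); form_simp|].
  by case=> *; first [by left; form_simp | by right; form_simp].
- case=> m [[y ym] [z zm] h]; case: m ym zm h => ym zm h.
  + by case: zm; case: z; intros; form_simp.
  + incomparable h VII_v.
  + incomparable h VII_u.
  + by case: ym; case: y; intros; form_simp.
- case=> m [[y ym] [z zm] h]; case: m ym zm h => [|p|||p|] ym zm h.
  + by case: zm; case: z; intros; form_simp.
  + incomparable h (VIII_v K).
  + incomparable h (VIII_v K).
  + incomparable h (VIII_u K).
  + incomparable h (VIII_u K).
  + by case: ym; case: y; intros; form_simp.
- case=> m [[y ym] [z zm] h]; case: m ym zm h => [|p|q|p q|||p|q|] ym zm h.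
  + by case: zm; case: z; intros; form_simp.
  + incomparable h (IX_v K).
  + incomparable h (IX_u K).
  + incomparable h (IX_u K).
  + incomparable h (IX_v K).
  + incomparable h (IX_u K).
  + incomparable h (IX_u K).
  + incomparable h (IX_v K).
  + by case: ym; case: y; intros; form_simp.
Qed.

Lemma has_disjoint_IX : has_disjoint (@form_leb FIX).
Proof.
exists (IX_u K), (IX_v K); split; [by exists (IX_0 K); form_simp..|].
by case=> [|p|q|p q|||p|q|]; form_simp => // _ _; case=> *; form_simp.
Qed.

(** Any two nonzero elements lie above a common nonzero one, given by a product of polynomials. *)
Lemma no_disjoint_II : ~ has_disjoint (@form_leb FII).
Proof.
case=> x [y [[z xz] [t yt] h]].
have bot0 : forall w, @form_leb FII (II_0 K) w by case=> *; form_simp.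
have lb p : @form_leb FII (II_p p) x -> @form_leb FII (II_p p) y -> False.
  by move=> px py; have := h _ px py (II_0 K); form_simp.
case: x xz lb {h} => [xz|p _|_]; first by case: xz.
  case: y yt => [yt|q _|_]; first by case: yt.
    by move/(_ (Qpoly_mul p q)); form_simp; apply.
  by move/(_ p); form_simp; apply.
case: y yt => [yt|q _|_]; first by case: yt.
  by move/(_ q); form_simp; apply.
by move/(_ p0); form_simp; apply.
Qed.

Lemma has_chain4_VIII : has_chain4 (@form_leb FVIII).
Proof.
exists (VIII_0 K), (VIII_v K), (VIII_pv p0), (VIII_L K).
by split; [..|split]; form_simp.
Qed.

Lemma no_chain4_VII : ~ has_chain4 (@form_leb FVII).
Proof.
case=> a [b [c [d [ab bc cd [ba cb dc]]]]]; move: ab bc cd ba cb dc.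
by case: a; case: b; form_simp => //; case: c; form_simp => //; case: d; form_simp.
Qed.

Lemma form_distinct i j : order_iso (form_le K i) (form_le K j) -> i = j.
Proof.
have le_leb k : order_iso (form_le K k) (@form_leb k).
  by exists id; split=> [|x y]; [exists id | exact: form_leP].
move=> ij; have {ij} h : order_iso (@form_leb i) (@form_leb j).
  apply: order_iso_trans (le_leb j); apply: order_iso_trans ij.
  exact: order_iso_sym.
have h' := order_iso_sym h.
have atom : atomic_form i = atomic_form j.
  apply/idP/idP => /has_atom_form a; apply/has_atom_form.
    exact: has_atom_iso a.
  exact: has_atom_iso h' a.
have local : local_form i = local_form j.
  apply/idP/idP => /has_greatest_proper_form a; apply/has_greatest_proper_form.
    exact: has_greatest_proper_iso a.
  exact: has_greatest_proper_iso h' a.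
have cut : cut_form i = cut_form j.
  apply/idP/idP => /has_cut_form a; apply/has_cut_form.
    exact: has_cut_iso a.
  exact: has_cut_iso h' a.
(* Among distinct forms the three Boolean invariants agree only on the pairs [FII], [FIX] and
   [FVII], [FVIII], each met in both orders. *)
case: i j h h' atom local cut => [] [] h h' //= _ _ _; exfalso.
- exact: no_disjoint_II (has_disjoint_iso h' has_disjoint_IX).
- exact: no_chain4_VII (has_chain4_iso h' has_chain4_VIII).
- exact: no_chain4_VII (has_chain4_iso h has_chain4_VIII).
- exact: no_disjoint_II (has_disjoint_iso h has_disjoint_IX).
Qed.
End Distinct.

Local Close Scope classical_set_scope.
Local Close Scope ring_scope.

Theorem theorem4 (K : fieldType) :
  [/\ forall E : fin_digraph, #|vertex E| = 2 ->
        is_lattice (@lambda_le K E) /\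
        exists i : lattice_form, order_iso (@lambda_le K E) (form_le K i),
      forall i : lattice_form, exists E : fin_digraph,
        #|vertex E| = 2 /\ order_iso (@lambda_le K E) (form_le K i)
    & forall i j : lattice_form, order_iso (form_le K i) (form_le K j) -> i = j].
Proof.
have iso_form := fun i => order_iso_sym (form_iso K i).
split=> [E E2|i|]; last exact: form_distinct.
  have [i iso] := two_vertex_iso K E2; split.
    exact: is_lattice_iso iso (form_pred_lattice K i).
  by exists i; exact: order_iso_trans iso (iso_form i).
have [E [E2 iso]] := form_example K i.
by exists E; split=> //; exact: order_iso_trans iso (iso_form i).
Qed.
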